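(* Let $G$ be a finite simple graph of order $n$ (that is, with $n\ge 1$ vertices) having no isolated vertex. Then $$\mathrm{SIG}(G)\leq \left\lfloor \frac{2n}{3}\right\rfloor+2.$$ In particular, if $n$ is not a multiple of $3$, then $$\mathrm{SIG}(G)\leq \left\lceil \frac{2n}{3}\right\rceil+1.$$
   Context: All graphs are finite and simple with nonempty vertex set; the order of a graph is its number of vertices, and an isolated vertex is a vertex of degree zero. For a natural number $d\ge 1$, equip $\mathbb{R}^d$ with the sup-norm ($L_\infty$) metric $\rho(x,y)=\max\{|x[j]-y[j]| : j=1,\dots,d\}$, where $z[j]$ denotes the $j$-th component of $z\in\mathbb{R}^d$. Let $P\subset\mathbb{R}^d$ be a finite set with at least two points. For $v\in P$ let $r_v=\min\{\rho(u,v): u\in P\setminus\{v\}\}$ be the distance from $v$ to its nearest neighbor in $P$, and let $B_v=\{u\in\mathbb{R}^d : \rho(u,v)<r_v\}$ be the open ball of radius $r_v$ about $v$ (the sphere of influence at $v$). The sphere of influence graph $\mathrm{SIG}^d_\infty(P)$ is the simple graph with vertex set $P$ in which two distinct points $u,v\in P$ are adjacent if and only if $B_u\cap B_v\neq\emptyset$ (equivalently, if and only if $\rho(u,v)<r_u+r_v$). A graph $G$ is realizable in $\mathbb{R}^d$ if there is a finite set $P\subset\mathbb{R}^d$ with at least two points such that $G$ is isomorphic to $\mathrm{SIG}^d_\infty(P)$. Every graph with at least two vertices and no isolated vertices is realizable in $\mathbb{R}^d$ for some $d$. The SIG-dimension of such a graph $G$ is $\mathrm{SIG}(G)=\min\{d\ge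 1 : G \text{ is realizable in } \mathbb{R}^d\}$. *)

(* Defs.v *)
From mathcomp Require Import all_boot all_order all_algebra finmap.
From mathcomp Require Import all_classical all_reals.
From mathcomp Require Import topology normedtype.
From mathcomp Require Import ring lra.

Set Implicit Arguments.
Unset Strict Implicit.
Unset Printing Implicit Defensive.

Import Order.TTheory GRing.Theory Num.Theory.
Import numFieldNormedType.Exports.

Local Open Scope classical_set_scope.
Local Open Scope ring_scope.

Record sgraph := SGraph {
  vertex :> finType;
  adj : rel vertex;
  adj_sym : symmetric adj;
  adj_irrefl : irreflexive adj }.

Definition graph_order (G : sgraph) : nat := #|G|.

Definition degree (G : sgraph) (v : G) : nat := #|[pred w | adj v w]|.

Definition isolated (G : sgraph) (v : G) : bool := degree v == 0%N.

Definition isomorphic (G H : sgraph) : Prop :=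
  exists2 f : G -> H, bijective f & forall u v, adj (f u) (f v) = adj u v.

(* The least element of S; the default x0 is returned when S has none. *)
Definition minimum disp (T : porderType disp) (x0 : T) (S : set T) : T :=
  xget x0 (S `&` lbound S).

Lemma minimumP disp (T : porderType disp) (x0 : T) (S : set T) (m : T) :
  S m -> lbound S m -> minimum x0 S = m.
Proof.
move=> Sm mS; apply: xget_unique => // y [Sy yS].
by apply/le_anti; rewrite (yS _ Sm) (mS _ Sy).
Qed.

Section sphere_of_influence.
Variables (R : realType) (d : nat).
Implicit Types (P : {fset 'rV[R]_d}) (u v : 'rV[R]_d).

(* The library norm on matrices is the sup norm, see rhoE. *)
Definition rho u v : R := `|u - v|.

Lemma rhoE u v : rho u v = \big[Num.max/0]_(j < d) `|u ord0 j - v ord0 j|.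
Proof.
rewrite /rho [LHS]mx_normrE; apply/le_anti/andP; split.
  apply/bigmax_leP; split=> [|[i j] _ /=]; first exact: bigmax_ge_id.
  by rewrite ord1 !mxE; apply: (@le_bigmax _ _ _ 0 (fun j => `|u ord0 j - v ord0 j|)).
apply/bigmax_leP; split=> [|j _ /=]; first exact: bigmax_ge_id.
have := @le_bigmax _ _ _ 0
  (fun ij : 'I_1 * 'I_d => `|(u - v) ij.1 ij.2|) (ord0, j).
by rewrite /= !mxE.
Qed.

Definition radius P v : R :=
  minimum 0 [set rho u v | u in [set u | u \in P /\ u != v]].

Lemma radiusP P v : (2 <= #|` P|)%N ->
  (exists u, [/\ u \in P, u != v & rho u v = radius P v]) /\
  (forall u, u \in P -> u != v -> radius P v <= rho u v).
Proof.
rewrite cardfE => /card_gt1P[a [b [_ _ ab]]].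
have [u0 u0v] : exists u : P, val u != v.
  have [av|av] := eqVneq (val a) v; last by exists a.
  by exists b; apply: contra_neq ab => bv; apply: val_inj; rewrite av bv.
have [m mv mmin] := @arg_minP _ _ _ u0 (fun u : P => val u != v)
  (fun u : P => rho (val u) v) u0v.
have lb u : u \in P -> u != v -> rho (val m) v <= rho u v.
  by move=> uP uv; apply: (mmin [` uP]%fset).
have -> : radius P v = rho (val m) v.
  apply: minimumP; first by exists (val m) => //; split => //; apply: valP.
  by move=> r [u [uP uv] <-]; apply: lb.
by split=> //; exists (val m); split=> //; apply: valP.
Qed.

Definition influence P v : set 'rV[R]_d := [set u | rho u v < radius P v].

Definition SIG_adj P : rel P := fun u v : P =>
  (u != v) && `[< influence P (val u) `&` influence P (val v) !=set0 >].

Lemma SIG_adj_sym P : symmetric (@SIG_adj P).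
Proof. by move=> u v; rewrite /SIG_adj eq_sym setIC. Qed.

Lemma SIG_adj_irrefl P : irreflexive (@SIG_adj P).
Proof. by move=> u; rewrite /SIG_adj eqxx. Qed.

Definition SIG_graph P : sgraph :=
  SGraph (@SIG_adj_sym P) (@SIG_adj_irrefl P).

End sphere_of_influence.

Definition realizable (R : realType) (d : nat) (G : sgraph) : Prop :=
  exists P : {fset 'rV[R]_d}, (2 <= #|` P|)%N /\ isomorphic G (SIG_graph P).

(* The default value 0 is not reached for the graphs considered here,
   see SIG_spec. *)
Definition SIG (R : realType) (G : sgraph) : nat :=
  minimum 0%N [set d | (1 <= d)%N /\ realizable R d G].

Section existence.
Variables (R : realType) (G : sgraph).
Hypotheses (G0 : (1 <= graph_order G)%N) (Gi : forall v : G, ~~ isolated v).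

Let dist (x y : G) : R := if x == y then 0 else if adj x y then 1 else 2.

Let pt (x : G) : 'rV[R]_#|G| := \row_j dist x (enum_val j).

Let distC x y : dist x y = dist y x.
Proof. by rewrite /dist eq_sym adj_sym. Qed.

Let dist_tri x y z : `|dist x z - dist y z| <= dist x y.
Proof.
rewrite ler_norml /dist; have [->|xy] := eqVneq x y.
  by rewrite subrr oppr0 lexx.
have [xz|xz] := eqVneq x z.
  by move: xy; rewrite xz (eq_sym z) => /negPf->; rewrite (adj_sym z); case: ifP => _; lra.
by have [->|yz] := eqVneq y z; do ?case: ifP => _; lra.
Qed.

Let rho_pt x y : rho (pt x) (pt y) = dist x y.
Proof.
rewrite rhoE; apply/le_anti/andP; split.
  apply/bigmax_leP; split=> [|j _]; last by rewrite !mxE.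
  by rewrite /dist; do 2?case: ifP.
apply: le_trans (@le_bigmax _ _ _ 0
  (fun j => `|pt x ord0 j - pt y ord0 j|) (enum_rank y)).
by rewrite !mxE enum_rankK {3}/dist eqxx subr0 ler_norm.
Qed.

Let pt_inj : injective pt.
Proof.
move=> x y xy; have := rho_pt x y; rewrite xy /rho subrr normr0 /dist.
by case: eqP => // _; case: ifP => _ /eqP; rewrite eq_sym ?oner_eq0 ?pnatr_eq0.
Qed.

Let P : {fset 'rV[R]_#|G|} := [fset pt x | x : G]%fset.

Let ptP x : pt x \in P.
Proof. exact: in_imfset. Qed.

Let PP p : p \in P -> exists x, p = pt x.
Proof. by case/imfsetP => x _ ->; exists x. Qed.

Let nbr (x : G) : exists y, adj x y.
Proof.
by have := Gi x; rewrite /isolated /degree => /pred0Pn[y xy]; exists y.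
Qed.

Let radius1 x : radius P (pt x) = 1.
Proof.
apply: minimumP.
  have [y xy] := nbr x; have yx : y != x.
    by apply: contraTneq xy => ->; rewrite adj_irrefl.
  exists (pt y); first by rewrite /= ptP (inj_eq pt_inj).
  by rewrite rho_pt distC /dist eq_sym (negPf yx) xy.
move=> r [p [/PP[y ->]] + <-]; rewrite (inj_eq pt_inj) => yx.
by rewrite rho_pt /dist (negPf yx); case: ifP => _; lra.
Qed.

Lemma realizable_graph_order : realizable R (graph_order G) G.
Proof.
exists P; split.
  have [x _] := card_gt0P G0; have [y xy] := nbr x.
  rewrite card_imfset //= -cardE.
  apply/card_gt1P; exists x, y; split => //.
  by apply: contraTneq xy => ->; rewrite adj_irrefl.
exists (fun x => [` ptP x]%fset : SIG_graph P).
  apply: inj_card_bij; first by move=> x y [/pt_inj].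
  by rewrite -cardfE card_imfset //= -cardE.
move=> x y; rewrite /= /SIG_adj /influence /= !radius1.
have [->|xy] := eqVneq x y; first by rewrite eqxx adj_irrefl.
rewrite -val_eqE /= (inj_eq pt_inj) xy /=.
apply/asboolP/idP => [[p [/= px py]]|axy].
  apply: contraT => naxy.
  have := rho_pt x y; rewrite /dist (negPf xy) (negPf naxy) => e.
  suff: rho (pt x) (pt y) < 2 by rewrite e ltxx.
  rewrite /rho (_ : pt x - pt y = (p - pt y) - (p - pt x)).
    by apply: le_lt_trans (ler_normB _ _) _; rewrite /rho in px py; lra.
  by apply/rowP => j; rewrite !mxE; ring.
have := rho_pt x y; rewrite /dist (negPf xy) axy => e.
have hx : rho (2^-1 *: (pt x + pt y)) (pt x) = 2^-1.
  rewrite /rho (_ : _ - _ = - (2^-1 *: (pt x - pt y))).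
    by rewrite normrN normrZ -/(rho _ _) e mulr1 ger0_norm // invr_ge0 ler0n.
  by apply/rowP => j; rewrite !mxE; field.
have hy : rho (2^-1 *: (pt x + pt y)) (pt y) = 2^-1.
  rewrite /rho (_ : _ - _ = 2^-1 *: (pt x - pt y)).
    by rewrite normrZ -/(rho _ _) e mulr1 ger0_norm // invr_ge0 ler0n.
  by apply/rowP => j; rewrite !mxE; field.
by exists (2^-1 *: (pt x + pt y)); split; rewrite /= ?hx ?hy; lra.
Qed.

Lemma SIG_spec :
  [/\ (1 <= SIG R G)%N, realizable R (SIG R G) G &
      forall d, (1 <= d)%N -> realizable R d G -> (SIG R G <= d)%N].
Proof.
pose Q d := `[< (1 <= d)%N /\ realizable R d G >].
have exQ : exists d, Q d.
  by exists (graph_order G); apply/asboolP; split => //; apply: realizable_graph_order.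
have [m /asboolP[m1 Rm] mmin] := ex_minnP exQ.
have -> : SIG R G = m.
  by apply: minimumP => // d [d1 Rd]; rewrite leEnat mmin //; apply/asboolP.
by split=> // d d1 Rd; apply: mmin; apply/asboolP.
Qed.

End existence.

(* Main.v *)
From mathcomp Require Import finmap all_classical all_reals.
From mathcomp Require Import topology normedtype.
Require Import Defs.
From mathcomp Require Import all_boot all_order all_algebra.
From mathcomp Require Import zify ring lra.

(** Coordinates are real functions on the vertices. Suppose that every vertex v
    carries a radius r v and has a neighbour of the same radius, its partner,
    from which no coordinate takes it farther than r v; that in every coordinate
    adjacent u and v differ by less than r u + r v; that non-adjacent u and v
    differ by at least r u + r v in some coordinate, and adjacent ones by at
    least the larger of their radii. Then r v is the distance from v to its
    nearest point and the sphere of influence graph is the given graph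
    ([representation_realizable]). So the graph with n vertices needs such radii
    and d coordinates with 3 d <= 2 n + 6 ([small_representation]). All radii
    are taken between 1 and 5 / 4; then vertices less than 2 apart in a
    coordinate satisfy the upper bound for adjacent pairs there.

    Hall's theorem cuts the vertex set into three parts
    ([deficiency_decomposition]): an independent set S, its set of neighbours A
    with #|A| < #|S| unless both are empty, and a rest covered by disjoint
    edges and cycles of the graph. Each vertex of A gets a coordinate of its
    own and the vertices of S get binary codes in about log #|S| further
    coordinates. As #|A| < #|S|, this costs at most 2 / 3 of a coordinate per
    vertex, up to an additive constant.

    The rest is treated by a process ([process]). A vertex k of the cover is
    touched: it leaves the cover together with one or two of its neighbours on
    its edge or cycle, in such a way that what remains is again covered by
    disjoint edges and cycles ([two_matchable_touch]). These neighbours are the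
    followers of k, their hub; hub and followers have the same radius, so they
    can serve as partners of each other. Radii decrease as the process goes on:
    in a coordinate made for k, earlier vertices can stay in an interval
    [0, rho] shorter than all their radii, hence close to their partners, while
    the smaller balls of later vertices have room to avoid or to meet the ball
    of k. An independent set K of touched vertices and followers is removed, the
    rest is placed recursively, and a block of coordinates that deals with all
    pairs meeting K is added. Three pairwise
    non-adjacent vertices cost two coordinates ([triple_block],
    [sibling_block]), and two non-adjacent vertices without a common
    non-neighbour cost one ([pair_block]). What has to be avoided is to place
    two non-adjacent followers of the same hub at opposite ends of a
    coordinate, since both have to stay near the hub.

    When no such step is possible, the vertices that are left consist of an
    independent set L of followers and of vertices adjacent to everything:
    if two followers in L were adjacent, they could return to the cover as an
    edge ([rematch_step]). At this point binary codes, on L and on the other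
    vertices, need only logarithmically many coordinates ([stuck_placement]). *)

Set Implicit Arguments.
Unset Strict Implicit.
Unset Printing Implicit Defensive.

(** * Matchings without fixed points *)

(** Induction on the size of X. If a nonempty proper subset U has exactly as many
    neighbours as elements, then U is matched first and the rest is matched into
    the elements that are not neighbours of U. If there is no such U, every
    inequality has room for one element, and any x may take any y in N x. *)
Lemma Hall (T : finType) (N : T -> {set T}) (X : {set T}) :
  (forall U : {set T}, U \subset X -> #|U| <= #|\bigcup_(u in U) N u|) ->
  exists f : T -> T, {in X &, injective f} /\ {in X, forall x, f x \in N x}.
Proof.
have [n] := ubnP #|X|; elim: n N X => // n IHn N X /ltnSE-leXn hall.
have [-> | /set0Pn[x xX]] := eqVneq X set0.
  by exists id; split=> x; rewrite inE.
pose NU (U : {set T}) := \bigcup_(u in U) N u.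
have [/existsP[U /and4P[sUX nzU nUX /eqP tight]] | notight] :=
  boolP [exists U : {set T}, [&& U \subset X, U != set0, U != X & #|U| == #|NU U|]].
  have ltUX : #|U| < #|X| by rewrite proper_card // properEneq nUX.
  have [f1 [inj1 f1N]] : exists f : T -> T,
      {in U &, injective f} /\ {in U, forall x, f x \in N x}.
    apply: IHn => [|U' sU']; first exact: leq_trans ltUX leXn.
    by apply: hall; apply: subset_trans sU' sUX.
  have [f2 [inj2 f2N]] : exists f : T -> T, {in X :\: U &, injective f} /\
      {in X :\: U, forall x, f x \in N x :\: NU U}.
    apply: IHn => [|U' sU'].
      apply: leq_trans leXn; apply: proper_card; apply/properP; split; first exact: subsetDl.
      have /set0Pn[z zU] := nzU; exists z; first exact: (subsetP sUX).
      by rewrite inE zU.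
    have UU' : [disjoint U & U'].
      rewrite disjoint_sym disjoints_subset; apply/subsetP => z /(subsetP sU').
      by rewrite !inE => /andP[].
    have /hall : U :|: U' \subset X.
      by rewrite subUset sUX (subset_trans sU') // subsetDl.
    rewrite bigcup_setU -/(NU U) -/(NU U').
    have -> : NU U :|: NU U' = NU U :|: (\bigcup_(u in U') (N u :\: NU U)).
      apply/setP => z; rewrite !inE; case zU: (z \in NU U) => //=.
      apply/bigcupP/bigcupP => -[u uU' zu]; exists u => //; last by case/setDP: zu.
      by rewrite inE zU.
    have := leq_card_setU (NU U) (\bigcup_(u in U') (N u :\: NU U)) => h1 h2.
    have := leq_trans h2 h1; rewrite cardsU disjoint_setI0 // cards0 subn0 tight.
    by rewrite leq_add2l.
  exists (fun z => if z \in U then f1 z else f2 z); split=> [y z yX zX | y yX].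
    case: ifP => yU; case: ifP => zU.
    - exact: inj1.
    - move=> e; have : f2 z \in N z :\: NU U by rewrite f2N // inE zU.
      rewrite inE -e => /andP[/negP[]]; apply/bigcupP; by exists y => //; apply: f1N.
    - move=> e; have : f2 y \in N y :\: NU U by rewrite f2N // inE yU.
      rewrite inE e => /andP[/negP[]]; apply/bigcupP; by exists z => //; apply: f1N.
    - by apply: inj2; rewrite inE ?yU ?zU.
  case: ifP => yU; first exact: f1N.
  by have : f2 y \in N y :\: NU U by [rewrite f2N // inE yU]; case/setDP.
have [y yN] : exists y, y \in N x.
  apply/set0Pn; rewrite -card_gt0; have /hall : [set x] \subset X by rewrite sub1set.
  by rewrite cards1 big_set1.
have [f [injf fN]] : exists f : T -> T, {in X :\ x &, injective f} /\
    {in X :\ x, forall z, f z \in N z :\ y}.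
  apply: IHn => [|U sU]; first by rewrite (cardsD1 x) xX in leXn.
  have [-> | nzU] := eqVneq U set0; first by rewrite cards0.
  have sUX : U \subset X by apply: subset_trans sU (subD1set _ _).
  have ltU : #|U| < #|NU U|.
    have := hall _ sUX; rewrite leq_eqVlt => /orP[/eqP e|//].
    case/negP: notight; apply/existsP; exists U; rewrite sUX nzU e eqxx andbT /=.
    apply: contraTneq sU => ->; apply/subsetPn; exists x => //.
    by rewrite !inE eqxx.
  have -> : \bigcup_(u in U) (N u :\ y) = NU U :\ y.
    apply/setP => z; rewrite !inE; apply/bigcupP/andP => [[u uU]|[zy /bigcupP[u uU zu]]].
      by rewrite !inE => /andP[-> zu]; split=> //; apply/bigcupP; exists u.
    by exists u; rewrite // !inE zy.
  by move: ltU; rewrite (cardsD1 y (NU U)); case: (y \in _); rewrite ?add1n ?ltnS // => /ltnW.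
exists (fun z => if z == x then y else f z); split=> [z w zX wX | z zX].
  have [->|zx] := eqVneq z x; have [->|wx] := eqVneq w x => // e.
  - by have := fN w; rewrite !inE wx wX -e eqxx => /(_ isT).
  - by have := fN z; rewrite !inE zx zX e eqxx => /(_ isT).
  - by apply: injf; rewrite // !inE ?zx ?wx.
have [->|zx] := eqVneq z x => //.
by have := fN z; rewrite !inE zx zX => /(_ isT)/andP[].
Qed.

Section TwoMatching.
Variables (T : finType) (e : rel T).
Hypotheses (e_sym : symmetric e) (e_irr : irreflexive e).
Implicit Types (X Y : {set T}) (x y : T).

(** The orbits of s are edges or directed cycles of the graph: X is covered by
    disjoint edges and cycles. *)
Definition two_matchable X : Prop :=
  exists s : T -> T, {in X &, injective s} /\
    {in X, forall x, s x \in X /\ e x (s x)}.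

Lemma two_matchable0 : two_matchable set0.
Proof. by exists id; split=> x; rewrite inE. Qed.

Lemma two_matchable_nbr X x : two_matchable X -> x \in X ->
  exists2 y, y \in X & e x y.
Proof. by case=> s [_ sP] /sP[]; exists (s x). Qed.

Lemma two_matchable_edge X x y : two_matchable X ->
  x \notin X -> y \notin X -> e x y -> two_matchable (x |: (y |: X)).
Proof.
case=> s [injs sP] xX yX exy.
have xy : x == y = false by apply: contraTF exy => /eqP->; rewrite e_irr.
exists (fun z => if z == x then y else if z == y then x else s z); split.
- have sx z : z \in X -> (x == s z) = false /\ (y == s z) = false.
    by move=> /sP[sz _]; split; apply: contraTF sz => /eqP<-.
  have sx' z : z \in X -> (s z == x) = false /\ (s z == y) = false.
    by move=> /sx; rewrite ![s z == _]eq_sym.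
  move=> z w; rewrite !inE.
  case: (eqVneq z x) => [->|zx]; case: (eqVneq w x) => [->|wx] //=.
  + move=> _; case: (eqVneq w y) => [-> _ /eqP|wy wX /eqP]; first by rewrite eq_sym xy.
    by rewrite (sx _ wX).2.
  + case: (eqVneq z y) => [-> _ _ /eqP|zy zX _ /eqP]; first by rewrite xy.
    by rewrite (sx' _ zX).2.
  + case: (eqVneq z y) => [->|zy]; case: (eqVneq w y) => [->|wy] //=.
    * by move=> _ wX /eqP; rewrite (sx _ wX).1.
    * by move=> zX _ /eqP; rewrite (sx' _ zX).1.
    * exact: injs.
- move=> z; rewrite !inE; have [->|zx] := eqVneq z x; first by rewrite eqxx orbT.
  have [->|zy] := eqVneq z y; first by rewrite eqxx e_sym exy.
  by move=> /= /sP[szX ->]; rewrite szX !orbT.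
Qed.

Lemma even_path_matching (p : seq T) : uniq p -> ~~ odd (size p) -> sorted e p ->
  exists t : T -> T, {in p &, injective t} /\ {in p, forall x, t x \in p /\ e x (t x)}.
Proof.
move=> up op ep.
suff [t [injt tP]] : two_matchable [set x in p].
  exists t; split=> [x y xp yp|x xp]; first by apply: injt; rewrite inE.
  by have [] := tP x; rewrite ?inE.
have [n] := ubnP (size p); elim: n p up op ep => // n IHn [|x [|y p]] //=.
  by move=> _ _ _ _; rewrite (_ : [set _ | _] = set0) //; apply: two_matchable0.
rewrite inE !negb_or negbK => /and3P[/andP[xy xp] yp up] op /andP[exy ep] sn.
have -> : [set z in x :: y :: p] = x |: (y |: [set z in p]).
  by apply/setP => z; rewrite !inE.
apply: two_matchable_edge; rewrite ?inE //.
apply: IHn => //; first exact: path_sorted ep.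
by move: sn; rewrite !ltnS; apply: leq_trans.
Qed.

(** The orbit of x is an edge or a cycle of the graph. Without x and its successor a path
    remains; if it has an odd number of vertices, the predecessor of x is
    removed too. A path with an even number of vertices is covered by edges. *)
Lemma two_matchable_touch X x : two_matchable X -> x \in X ->
  exists F : {set T}, [/\ F \subset X, F != set0, #|F| <= 2,
    {in F, forall y, e x y} & two_matchable ((X :\ x) :\: F)].
Proof.
case=> s0 [injs0 sP0] xX.
pose s z := if z \in X then s0 z else z.
have sX z : z \in X -> s z \in X /\ e z (s z) by rewrite /s => zX; rewrite zX; apply: sP0.
have injs : injective s.
  move=> y z; rewrite /s; case: ifP => yX; case: ifP => zX //.
  - exact: injs0.
  - by move=> eyz; move: (sP0 y yX); rewrite eyz zX => -[].
  - by move=> eyz; move: (sP0 z zX); rewrite -eyz yX => -[].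
have orbX z : z \in orbit s x -> z \in X.
  rewrite -fconnect_orbit => /iter_findex <-.
  by elim: (findex _ _ _) => //= k /sX[].
have closed z : (s z \in orbit s x) = (z \in orbit s x).
  rewrite -!fconnect_orbit; apply/idP/idP => h.
    by apply: connect_trans h _; rewrite fconnect_sym //; apply: fconnect1.
  by apply: connect_trans h _; apply: fconnect1.
(* p is the part of the orbit of x that stays. *)
have build (F : {set T}) (p : seq T) : ~~ odd (size p) -> uniq p -> sorted e p ->
    (forall z, (z \in orbit s x) = [|| z == x, z \in F | z \in p]) ->
    x \notin p -> {in F, forall z, z \notin p} ->
    two_matchable ((X :\ x) :\: F).
  move=> op up ep orbE xp Fp.
  have [t [injt tP]] := even_path_matching up op ep.
  have inXF z : z \in (X :\ x) :\: F -> z \notin p -> z \notin orbit s x.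
    by rewrite !inE orbE => /and3P[/negPf-> /negPf-> _] /negPf->.
  have XFin z : z \notin orbit s x -> z \in X -> z \in (X :\ x) :\: F.
    by rewrite orbE !inE !negb_or => /and3P[-> -> _] ->.
  have pin z : z \in p -> z \in (X :\ x) :\: F.
    move=> zp; rewrite !inE orbX ?orbE ?zp ?orbT // andbT.
    apply/andP; split; first by apply: contraL zp; apply: Fp.
    by apply: contraTneq zp => ->.
  exists (fun z => if z \in p then t z else s z); split=> [y z yX zX | z zX].
    case: ifP => yp; case: ifP => zp.
    - exact: injt.
    - move=> eq; have [+ _] := tP y yp; rewrite eq => szp.
      by have := inXF z zX (negbT zp); rewrite -closed orbE szp !orbT.
    - move=> eq; have [+ _] := tP z zp; rewrite -eq => syp.
      by have := inXF y yX (negbT yp); rewrite -closed orbE syp !orbT.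
    - exact: injs.
  case: ifP => zp; first by have [? ?] := tP z zp; split=> //; apply: pin.
  have zXX : z \in X by move: zX; rewrite !inE => /and3P[].
  have [sz ez] := sX z zXX; split=> //; apply: XFin => //.
  by rewrite closed; apply: inXF => //; rewrite zp.
have orbc : orbit s x = x :: behead (orbit s x) by rewrite /orbit -orderSpred.
have : path e x (rcons (behead (orbit s x)) x).
  have : all (mem X) (rcons (behead (orbit s x)) x).
    rewrite all_rcons /= xX; apply/allP => z /mem_behead; exact: orbX.
  have : fcycle s (orbit s x) by apply: cycle_orbit.
  rewrite orbc /=; move: (behead _) => p.
  elim: p {1 2 5}x xX => [|y p IHp] z zX /=.
    move=> /andP[/eqP sz _]; have [_ ez] := sX z zX. by rewrite -sz ez.
  by move=> /andP[/eqP <- sp] /andP[yX pX]; have [_ ->] := sX z zX; apply: IHp.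
have := orbit_uniq s x.
have orbE z : (z \in orbit s x) = (z == x) || (z \in behead (orbit s x)).
  by rewrite orbc inE.
have subX : {subset behead (orbit s x) <= X} by move=> z zp; apply: orbX; rewrite orbE zp orbT.
rewrite orbc; move: (behead _) orbE subX => [|y p] orbE subX.
  by rewrite /= e_irr.
rewrite rcons_path /= inE negb_or => /and3P[/andP[xy xp] yp up].
move=> /andP[/andP[exy ep] elast].
have [op|] := boolP (odd (size p)); last first.
  move=> op; exists [set y]; split.
  - by rewrite sub1set subX // mem_head.
  - by apply/set0Pn; exists y; rewrite inE.
  - by rewrite cards1.
  - by move=> z; rewrite inE => /eqP->.
  - apply: (build _ p op up (path_sorted ep)) => //.
      by move=> z; rewrite orbE !inE.
    by move=> z; rewrite inE => /eqP->.
case/lastP: p => [//|p z] in orbE subX xp yp up op ep elast *.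
move: elast; rewrite last_rcons => ezx.
move: up; rewrite rcons_uniq => /andP[zp up].
move: xp yp; rewrite !mem_rcons !inE !negb_or => /andP[xz xp] /andP[yz yp].
exists [set y; z]; split.
- apply/subsetP => w; rewrite !inE => /orP[] /eqP->; apply: subX; rewrite ?mem_head //.
  by rewrite inE mem_rcons mem_head orbT.
- by apply/set0Pn; exists y; rewrite !inE eqxx.
- by rewrite cards2; case: (y != z).
- by move=> w; rewrite !inE => /orP[] /eqP-> //; rewrite e_sym.
- apply: (build _ p) => //.
  + by move: op; rewrite size_rcons /=.
  + by move: ep; rewrite rcons_path => /andP[/path_sorted].
  + by move=> w; rewrite orbE !inE mem_rcons inE !orbA.
  + by move=> w; rewrite !inE => /orP[] /eqP->.
Qed.
End TwoMatching.

(** * Removing the vertices that violate Hall's condition *)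

Section Decomposition.
Variables (T : finType) (e : rel T).
Hypothesis e_sym : symmetric e.
Implicit Types (S U X : {set T}).

Definition neighbours S : {set T} := \bigcup_(s in S) [set v | e s v].

Lemma neighboursP S v : reflect (exists2 s, s \in S & e s v) (v \in neighbours S).
Proof. by apply: (iffP bigcupP) => -[s sS]; rewrite ?inE => sv; exists s; rewrite ?inE. Qed.

Lemma Hall_two_matchable X :
  (forall U, U \subset X -> #|U| <= #|neighbours U :&: X|) -> two_matchable e X.
Proof.
move=> hall; have [U sU|f [injf fN]] := @Hall T (fun x => [set v | e x v] :&: X) X.
  by have := hall U sU; rewrite /neighbours big_distrl.
exists f; split=> // x /fN; by rewrite !inE => /andP[-> ->].
Qed.

(** Let S0 maximize #|S0| - #|N(S0)|. If this is positive, the vertices of S0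
    without a neighbour in S0 form a set S with the same difference. The set
    outside S and A = N(S) satisfies Hall's condition within itself, as a
    violating set could be added to S to increase the difference. *)
Lemma deficiency_decomposition : exists A S : {set T},
  [/\ [disjoint A & S],
      {in S, forall s v, e s v -> v \in A},
      {in A, forall a, exists2 s, s \in S & e s a},
      (A == set0) && (S == set0) || (#|A| < #|S|) &
      two_matchable e (~: (A :|: S))].
Proof.
(* The difference #|S| - #|N(S)|, shifted by #|T| to stay nonnegative. *)
pose def S := #|S| + #|~: neighbours S|.
have [S0 _ S0max] := @arg_maxnP _ set0 predT def isT.
have defE S : def S + #|neighbours S| = #|S| + #|T| by rewrite /def -(cardsC (neighbours S)); lia.
have [small|big] := leqP (def S0) #|T|.
  exists set0, set0; split=> [|x|x||].
  - by rewrite disjoints_subset sub0set.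
  - by rewrite inE.
  - by rewrite inE.
  - by rewrite !eqxx.
  - rewrite setU0 setC0; apply: Hall_two_matchable => U _; rewrite setIT.
    have := S0max U isT; have := defE U; lia.
pose S := S0 :\: neighbours S0; pose A := neighbours S.
have nS0 : #|S0 :&: neighbours S0| <= #|neighbours S0 :\: A|.
  apply: subset_leq_card; apply/subsetP => v; rewrite !inE => /andP[vS0 ->]; rewrite andbT.
  apply/neighboursP => -[s]; rewrite !inE => /andP[/negP sA sS0] sv; apply: sA.
  by apply/neighboursP; exists v; rewrite // e_sym.
have Smax U : def U <= def S.
  apply: leq_trans (S0max U isT) _.
  have sub : A \subset neighbours S0.
    apply/subsetP => v /neighboursP[s]; rewrite inE => /andP[_ sS0] sv.
    by apply/neighboursP; exists s.
  have := cardsID (neighbours S0) S0; have := cardsID A (neighbours S0).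
  by rewrite (setIidPr sub); have := defE S; have := defE S0; rewrite -/S -/A; lia.
have SA : [disjoint A & S].
  rewrite disjoints_subset; apply/subsetP => v /neighboursP[s]; rewrite !inE => /andP[_ sS0] sv.
  by rewrite negb_and negbK; apply/orP; left; apply/neighboursP; exists s.
exists A, S; split=> //.
- by move=> s sS v sv; apply/neighboursP; exists s.
- by move=> a /neighboursP.
- by apply/orP; right; have := leq_trans big (Smax _); have := defE S; rewrite -/A; lia.
- apply: Hall_two_matchable => U sU.
  have dU : [disjoint U & S].
    by rewrite disjoints_subset (subset_trans sU) // setCS subsetUr.
  have uE : neighbours (S :|: U) = A :|: (neighbours U :&: ~: (A :|: S)).
    apply/setP => v; rewrite /neighbours bigcup_setU -/(neighbours S) -/(neighbours U) -/A !inE.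
    case vA: (v \in A) => //=; case vU: (v \in neighbours U) => //=.
    have /neighboursP[u uU uv] : v \in neighbours U by rewrite vU.
    apply/esym/negP => vS; have := subsetP sU u uU; rewrite !inE => /norP[/negP[]].
    apply/neighboursP; exists v; first by rewrite !inE.
    by rewrite e_sym.
  have := Smax (S :|: U); have := defE (S :|: U); have := defE S.
  rewrite uE -/A; have := (leq_card_setU A (neighbours U :&: ~: (A :|: S))).1.
  have := cardsU S U; rewrite setIC (disjoint_setI0 dU) cards0; lia.
Qed.

End Decomposition.

(** * Binary codes *)

Definition bit (n i : nat) : bool := odd (n %/ 2 ^ i).

Lemma bitS n i : bit n i.+1 = bit (n %/ 2) i.
Proof. by rewrite /bit expnS divnMA. Qed.

Lemma bit_neq B m n : m < 2 ^ B -> n < 2 ^ B -> m != n ->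
  exists2 i, i < B & bit m i != bit n i.
Proof.
elim: B m n => [|B IHB] m n; first by rewrite expn0; lia.
rewrite expnS => mB nB mn.
have [eq_odd|neq_odd] := eqVneq (odd m) (odd n); last first.
  by exists 0; rewrite // /bit expn0 !divn1.
have [i iB ib] : exists2 i, i < B & bit (m %/ 2) i != bit (n %/ 2) i.
  apply: IHB; [lia|lia|].
  by apply: contra_neq mn => mn2; rewrite -(odd_double_half m) -(odd_double_half n) -!divn2 mn2 eq_odd.
by exists i.+1; rewrite ?bitS.
Qed.

(** Only 2 ^ B - 1 has B binary digits that are all equal to one. *)
Lemma bit_zero B m : m.+1 < 2 ^ B -> exists2 i, i < B & ~~ bit m i.
Proof.
elim: B m => [|B IHB] m; first by rewrite expn0; lia.
rewrite expnS => mB; have [om|em] := boolP (odd m); last first.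
  by exists 0; rewrite // /bit expn0 divn1.
have [i iB ib] : exists2 i, i < B & ~~ bit (m %/ 2) i by apply: IHB; lia.
by exists i.+1; rewrite ?bitS.
Qed.

Lemma up_log2_third n : 3 * up_log 2 n <= n + 4.
Proof.
suff : n <= 2 ^ ((n + 4) %/ 3) by move=> /(up_log_min (ltnSn 1)); lia.
have [k] := ubnP n; elim: k n => // k IHk n nk.
have [|n6] := leqP n 5; first by move: n {nk} => [|[|[|[|[|[|n]]]]]].
have := IHk (n - 3); rewrite (_ : (n + 4) %/ 3 = ((n - 3 + 4) %/ 3).+1) ?expnS; lia.
Qed.

Lemma up_log2_clique m : 3 * up_log 2 m.+1 <= 2 * m + 2.
Proof. by have := up_log2_third m.+1; move: m => [|[|[|m]]] //; lia. Qed.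

Lemma up_log2_clique1 m : 3 * up_log 2 (maxn m 1).+1 <= 2 * m + 3.
Proof. by have := up_log2_third (maxn m 1).+1; move: m => [|[|m]] //; lia. Qed.

Lemma up_log2_independent l : 1 < l -> l != 3 -> 3 * up_log 2 l + 1 <= 2 * l.
Proof. by have := up_log2_third l; move: l => [|[|[|[|[|l]]]]] //; lia. Qed.

(** The cost of the final codes: l vertices in the independent part, m others. *)
Lemma up_log2_stuck l m : l != 1 -> l != 3 ->
  3 * (up_log 2 l + up_log 2 (maxn m (0 < l)).+1) <= 2 * (m + l) + 2.
Proof.
case: l => [|[|l]] // _ l3; first by rewrite up_log0 maxn0 addn0 add0n up_log2_clique.
have := up_log2_clique1 m; have := up_log2_independent (isT : 1 < l.+2) l3.
rewrite [maxn m (0 < _)]/=; lia.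
Qed.

Import Order.TTheory GRing.Theory Num.Theory.
Local Open Scope ring_scope.

(** * Coordinates that place two non-adjacent vertices *)

Ltac contra_eq := exfalso;
  repeat match goal with H : is_true (_ != _) |- _ => move/eqP in H end; congruence.

Section Maps.
Variables (R : realFieldType) (T : finType) (e : rel T).
Hypotheses (e_sym : symmetric e) (e_irr : irreflexive e).
Variable (r : T -> R).
Implicit Types (f : T -> R) (u v : T).

(** The three conditions on coordinates in [representation] below. *)
Definition compatible f := forall u v, e u v -> `|f u - f v| < r u + r v.
Definition covers f u v := r u + r v <= `|f u - f v|.
Definition separates f u v := (r u <= `|f u - f v|) && (r v <= `|f u - f v|).

Lemma coversC f u v : covers f u v = covers f v u.
Proof. by rewrite /covers distrC addrC. Qed.

Lemma separatesC f u v : separates f u v = separates f v u.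
Proof. by rewrite /separates distrC andbC. Qed.

Lemma coversl f u v : r u + r v <= f v - f u -> covers f u v.
Proof. by move=> h; rewrite /covers distrC (le_trans h) ?ler_norm. Qed.

Lemma coversr f u v : r u + r v <= f u - f v -> covers f u v.
Proof. by move=> h; rewrite /covers (le_trans h) ?ler_norm. Qed.

Lemma separatesl f u v : r u <= f v - f u -> r v <= f v - f u -> separates f u v.
Proof. by move=> hu hv; rewrite /separates distrC !(le_trans _ (ler_norm _)). Qed.

Lemma separatesr f u v : r u <= f u - f v -> r v <= f u - f v -> separates f u v.
Proof. by move=> hu hv; rewrite /separates !(le_trans _ (ler_norm _)). Qed.

Implicit Types (W : {set T}) (c : T -> T).

(** The situation in which coordinates for a removed independent set are made.
    W is the set of the vertices that were placed after this removal. They have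
    radius at most rho, except for the followers whose partner is a vertex
    outside W; all large radii exceed rho + delta. *)
Record calibrated W c (rho delta : R) : Prop := Calibrated {
  calibrated_rho : 1 <= rho;
  calibrated_delta : 0 < delta;
  calibrated_ge1 : forall v, 1 <= r v;
  calibrated_le54 : forall v, r v <= 5 / 4;
  calibrated_out : forall v, v \notin W -> rho + delta < r v;
  calibrated_adj : forall w, w \in W -> e w (c w);
  calibrated_partner : forall w, w \in W -> r (c w) = r w;
  calibrated_cases : forall w, w \in W ->
    (c w \in W) && (r w <= rho) || (c w \notin W) && (rho + delta < r w) }.

Definition placed W c v := [&& v \notin W, e v (c v) & r (c v) == r v].

Section Pair.
Variables (W : {set T}) (c : T -> T) (rho delta : R) (a b : T).
Hypotheses (cal : calibrated W c rho delta) (pla : placed W c a) (plb : placed W c b).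
Hypotheses (nab : ~~ e a b) (ab : a != b).
Hypothesis cab : c a \notin W -> c a != c b.

Let r1 : forall v, 1 <= r v. Proof. exact: calibrated_ge1 cal. Qed.
Let r54 : forall v, r v <= 5 / 4. Proof. exact: calibrated_le54 cal. Qed.
Let rout v : v \notin W -> rho + delta < r v. Proof. exact: calibrated_out cal v. Qed.
Let adjc w : w \in W -> e w (c w). Proof. exact: calibrated_adj cal w. Qed.
Let rc w : w \in W -> r (c w) = r w. Proof. exact: calibrated_partner cal w. Qed.
Let cW w : w \in W -> (c w \in W) && (r w <= rho) || (c w \notin W) && (rho + delta < r w).
Proof. exact: calibrated_cases cal w. Qed.
Let aW : a \notin W. Proof. by case/and3P: pla. Qed.
Let bW : b \notin W. Proof. by case/and3P: plb. Qed.
Let adja : e a (c a). Proof. by case/and3P: pla. Qed.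
Let adjb : e b (c b). Proof. by case/and3P: plb. Qed.
Let ra : r (c a) = r a. Proof. by case/and3P: pla => _ _ /eqP. Qed.
Let rb : r (c b) = r b. Proof. by case/and3P: plb => _ _ /eqP. Qed.

(** The ball of a ends at 0 and the ball of b begins at rho. A vertex of W not
    adjacent to a, or else not adjacent to b, is placed so that its ball touches
    the ball of that vertex. Of the other vertices, those that have a or b as
    partner and the partners of a and b outside W are at the end of the
    respective ball, hence at distance r a or r b from its centre, and the rest
    is in the middle. *)
Definition pair_map v : R :=
  if v == a then - r a else if v == b then rho + r b else
  if v \in W then
    if ~~ e a v then r v else if ~~ e b v then rho - r v else
    if c v == a then 0 else if c v == b then rho else rho / 2
  else if v == c a then 0 else if v == c b then rho else rho / 2.

Let fa : pair_map a = - r a. Proof. by rewrite /pair_map eqxx. Qed.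
Let fb : pair_map b = rho + r b. Proof. by rewrite /pair_map eq_sym (negPf ab) eqxx. Qed.

(** The branches of [pair_map] away from a and b, with the consequences for the
    radius; the boolean indices are v \in W, e a v and e b v. *)
Variant pair_spec v : bool -> bool -> bool -> R -> Type :=
 | PairZ of v \in W & ~~ e a v : pair_spec v true false (e b v) (r v)
 | PairY of v \in W & e a v & ~~ e b v : pair_spec v true true false (rho - r v)
 | PairFa of v \in W & e a v & e b v & c v = a & r v = r a : pair_spec v true true true 0
 | PairFb of v \in W & e a v & e b v & c v = b & r v = r b : pair_spec v true true true rho
 | PairM of v \in W & e a v & e b v & c v != a & c v != b : pair_spec v true true true (rho / 2)
 | PairHa of v \notin W & v = c a & r v = r a & rho + delta < r v : pair_spec v false (e a v) (e b v) 0
 | PairHb of v \notin W & v = c b & v != c a & r v = r b & rho + delta < r v : pair_spec v false (e a v) (e b v) rho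
 | PairP of v \notin W & v != c a & v != c b & rho + delta < r v : pair_spec v false (e a v) (e b v) (rho / 2).

Lemma pairP v : v != a -> v != b -> pair_spec v (v \in W) (e a v) (e b v) (pair_map v).
Proof.
move=> /negPf va /negPf vb; rewrite /pair_map va vb.
have [vW|vW] := boolP (v \in W).
  have [eav|eav] := boolP (e a v); last exact: PairZ.
  have [ebv|ebv] := boolP (e b v); last exact: PairY.
  have [cva|cva] := eqVneq (c v) a; first by apply: PairFa; rewrite // -cva rc.
  have [cvb|cvb] := eqVneq (c v) b; first by apply: PairFb; rewrite // -cvb rc.
  exact: PairM.
have [vca|vca] := eqVneq v (c a); first by apply: PairHa; rewrite ?rout // vca.
have [vcb|vcb] := eqVneq v (c b); last by apply: PairP; rewrite ?rout.
by apply: PairHb; rewrite ?rout // vcb.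
Qed.

Let constants : [/\ 1 <= rho, 0 < delta, rho + delta < 5 / 4, rho + delta < r a
  & rho + delta < r b].
Proof.
by split; rewrite ?rout ?(lt_le_trans (rout aW) (r54 a)) //;
  [exact: calibrated_rho cal | exact: calibrated_delta cal].
Qed.

Ltac arith := case: constants => *; lra.
Ltac abs_lra := rewrite ?(ltr_norml, ler_norml); apply/andP; split; arith.

Let bounds_in w : w \in W -> rho - r w <= pair_map w <= r w.
Proof.
move=> wW; have wa : w != a by apply: contraNneq aW => <-.
have wb : w != b by apply: contraNneq bW => <-.
by have ? := r1 w; move: (wW); case: (pairP wa wb) => // *; apply/andP; split; arith.
Qed.

Let bounds_out v : v \notin W -> v != a -> v != b -> 0 <= pair_map v <= rho.
Proof.
by move=> vW va vb; move: (vW); case: (pairP va vb) => // *; apply/andP; split; arith.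
Qed.

(** Two vertices that are both close to rho / 2 are compatible. *)
Lemma pair_map_center v : v != a -> v != b -> `|pair_map v - rho / 2| < r v.
Proof.
move=> va vb; have ? := r1 v; have [/bounds_in/andP[? ?]|vW] := boolP (v \in W).
  by abs_lra.
have /andP[? ?] := bounds_out vW va vb; abs_lra.
Qed.

Let pair_compat_a v : e a v -> `|pair_map a - pair_map v| < r a + r v.
Proof.
move=> eav; have va : v != a by apply: contraTneq eav => ->; rewrite e_irr.
have vb : v != b by apply: contraTneq eav => ->.
rewrite fa; have ? := r1 v; have ? := r54 v.
have := eav; case: (pairP va vb) => * //; abs_lra.
Qed.

Let pair_compat_b v : e b v -> `|pair_map b - pair_map v| < r b + r v.
Proof.
move=> ebv; have vb : v != b by apply: contraTneq ebv => ->; rewrite e_irr.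
have va : v != a by apply: contraTneq ebv => ->; rewrite e_sym.
rewrite fb; have ? := r1 v; have ? := r54 v.
have := ebv; case: (pairP va vb) => * //; abs_lra.
Qed.

Lemma pair_map_compatible : compatible pair_map.
Proof.
move=> u v euv.
have [ua|ua] := eqVneq u a; first by rewrite ua; apply: pair_compat_a; rewrite -ua.
have [ub|ub] := eqVneq u b; first by rewrite ub; apply: pair_compat_b; rewrite -ub.
have [va|va] := eqVneq v a.
  by rewrite va distrC [r u + _]addrC; apply: pair_compat_a; rewrite -va e_sym.
have [vb|vb] := eqVneq v b.
  by rewrite vb distrC [r u + _]addrC; apply: pair_compat_b; rewrite -vb e_sym.
have := pair_map_center ua ub; have := pair_map_center va vb.
by rewrite !ltr_norml => /andP[? ?] /andP[? ?]; abs_lra.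
Qed.

Lemma pair_map_partner w : w \in W -> `|pair_map w - pair_map (c w)| <= r w.
Proof.
move=> wW; have [? ?] := (r1 w, r54 w).
have wa : w != a by apply: contraNneq aW => <-.
have wb : w != b by apply: contraNneq bW => <-.
have := adjc wW; have [cwa|cwa] := eqVneq (c w) a.
  rewrite cwa fa e_sym => eaw; have ? : r w = r a by rewrite -cwa rc.
  by move: (wW) eaw; case: (pairP wa wb) => // *; (abs_lra || (have := ab; move=> ?; contra_eq)).
have [cwb|cwb] := eqVneq (c w) b.
  rewrite cwb fb e_sym => ebw; have ? : r w = r b by rewrite -cwb rc.
  by move: (wW) ebw; case: (pairP wa wb) => // *; (abs_lra || (have := ab; move=> ?; contra_eq)).
move=> _; have ? := rc wW; have /andP[? ?] := bounds_in wW.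
case/orP: (cW wW) => /andP[cwW ?].
  by have /andP[? ?] := bounds_in cwW; abs_lra.
by have /andP[? ?] := bounds_out cwW cwa cwb; abs_lra.
Qed.

Lemma pair_map_out u v : u \notin W -> v \notin W -> u != a -> u != b -> v != a -> v != b ->
  `|pair_map u - pair_map v| <= r u.
Proof.
move=> uW vW ua ub va vb; have ? := rout uW.
by have /andP[? ?] := bounds_out uW ua ub; have /andP[? ?] := bounds_out vW va vb; abs_lra.
Qed.

Lemma pair_map_partner_a : c a \notin W -> `|pair_map a - pair_map (c a)| <= r a.
Proof.
move=> caW; have va : c a != a by apply: contraTneq adja => ->; rewrite e_irr.
have vb : c a != b by apply: contraTneq adja => ->.
rewrite fa {1}/pair_map (negPf va) (negPf vb) (negPf caW) eqxx; abs_lra.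
Qed.

Lemma pair_map_partner_b : c b \notin W -> `|pair_map b - pair_map (c b)| <= r b.
Proof.
move=> cbW; have vb : c b != b by apply: contraTneq adjb => ->; rewrite e_irr.
have va : c b != a by apply: contraTneq adjb => ->; rewrite e_sym.
have cba : c b != c a.
  by apply/negP => /eqP cba; have := cab; rewrite -cba cbW eqxx => /(_ isT).
rewrite fb {1}/pair_map (negPf va) (negPf vb) (negPf cbW) (negPf cba) eqxx; abs_lra.
Qed.

Lemma pair_map_covers : covers pair_map a b.
Proof. by apply: coversl; rewrite fa fb; arith. Qed.

Lemma pair_map_covers_a w : w \in W -> ~~ e a w -> covers pair_map a w.
Proof.
move=> wW naw; have wa : w != a by apply: contraNneq aW => <-.
have wb : w != b by apply: contraNneq bW => <-.
apply: coversl; rewrite fa; move: naw wW; case: (pairP wa wb) => * //; arith.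
Qed.

Lemma pair_map_covers_b w : w \in W -> e a w -> ~~ e b w -> covers pair_map b w.
Proof.
move=> wW aw nbw; have wa : w != a by apply: contraNneq aW => <-.
have wb : w != b by apply: contraNneq bW => <-.
apply: coversr; rewrite fb; move: aw nbw wW; case: (pairP wa wb) => * //; arith.
Qed.

Lemma pair_map_separates_a v : e a v -> (v \in W -> r v <= rho) -> separates pair_map a v.
Proof.
move=> eav low; have va : v != a by apply: contraTneq eav => ->; rewrite e_irr.
have vb : v != b by apply: contraTneq eav => ->.
have [? ?] := (r1 v, r54 v); apply: separatesl; rewrite fa; move: eav; case: (pairP va vb) => // *.
all: try (assert (r v <= rho) by (apply low; assumption)); arith.
Qed.

Lemma pair_map_separates_b v : e b v -> (v \in W -> r v <= rho) -> separates pair_map b v.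
Proof.
move=> ebv low; have vb : v != b by apply: contraTneq ebv => ->; rewrite e_irr.
have va : v != a by apply: contraTneq ebv => ->; rewrite e_sym.
have [? ?] := (r1 v, r54 v); apply: separatesr; rewrite fb; move: ebv; case: (pairP va vb) => // *.
all: try (assert (r v <= rho) by (apply low; assumption)); arith.
Qed.
End Pair.
End Maps.

(** * Coordinates that place three independent vertices *)

Section Triple.
Variables (R : realFieldType) (T : finType) (e : rel T).
Hypotheses (e_sym : symmetric e) (e_irr : irreflexive e).
Variable (r : T -> R).
Variables (W : {set T}) (c : T -> T) (rho delta : R) (a b d : T).
Hypothesis cal : calibrated e r W c rho delta.
Hypotheses (pla : placed e r W c a) (plb : placed e r W c b) (pld : placed e r W c d).
Hypotheses (nab : ~~ e a b) (nad : ~~ e a d) (nbd : ~~ e b d).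
Hypotheses (ab : a != b) (ad : a != d) (bd : b != d).
Hypotheses (cab : c b \notin W -> c b != c a) (cad : c d \notin W -> c d != c a)
  (cbd : c d \notin W -> c d != c b).
(* If the partner of a is a hub, its other follower is adjacent to a. *)
Hypothesis sibling_a : forall w, w \in W -> c a \notin W -> c w = c a -> e a w.

Let r1 : forall v, 1 <= r v. Proof. exact: calibrated_ge1 cal. Qed.
Let r54 : forall v, r v <= 5 / 4. Proof. exact: calibrated_le54 cal. Qed.
Let rout v : v \notin W -> rho + delta < r v. Proof. exact: calibrated_out cal v. Qed.
Let adjc w : w \in W -> e w (c w). Proof. exact: calibrated_adj cal w. Qed.
Let rc w : w \in W -> r (c w) = r w. Proof. exact: calibrated_partner cal w. Qed.
Let cW w : w \in W -> (c w \in W) && (r w <= rho) || (c w \notin W) && (rho + delta < r w).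
Proof. exact: calibrated_cases cal w. Qed.
Let aW : a \notin W. Proof. by case/and3P: pla. Qed.
Let bW : b \notin W. Proof. by case/and3P: plb. Qed.
Let dW : d \notin W. Proof. by case/and3P: pld. Qed.
Let adja : e a (c a). Proof. by case/and3P: pla. Qed.
Let adjb : e b (c b). Proof. by case/and3P: plb. Qed.
Let adjd : e d (c d). Proof. by case/and3P: pld. Qed.
Let ra : r (c a) = r a. Proof. by case/and3P: pla => _ _ /eqP. Qed.
Let rb : r (c b) = r b. Proof. by case/and3P: plb => _ _ /eqP. Qed.
Let rd : r (c d) = r d. Proof. by case/and3P: pld => _ _ /eqP. Qed.

Let out v := [&& v != a, v != b & v != d].

(** Three independent vertices a, b and d need two coordinates. In the first,
    the balls of a and b end at 0 and at delta and the ball of d begins at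
    rho + delta; in the second, the ball of b ends at 0 and the balls of d and a
    begin at rho and at rho + delta. When two of the three vertices are at the
    same end, a ball that touches the inner one also avoids the outer one,
    whereas a ball that touches the outer one still meets the inner one, by
    delta. In this way each vertex of W is kept away from exactly those of a, b
    and d to which it is not adjacent, in one of the two coordinates. As for
    [pair_map], the partnerships of a, b and d determine the remaining values.
    A vertex with partner b that is not adjacent to a is special: in the first
    coordinate it has to stay at the end of the ball of b, and it is the second
    one that lets it touch the ball of a, at distance rho + delta < r b from b. *)
Definition triple_map1 v : R :=
  if v == a then - r a else if v == b then delta - r b else
  if v == d then rho + delta + r d else
  if v \in W then
    if ~~ e a v then
      if ~~ e b v then delta + r v else if c v == b then delta else r v
    else if ~~ e d v then rho + delta - r v else
    if c v == a then 0 else if c v == b then delta else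
    if c v == d then rho + delta else (rho + delta) / 2
  else if v == c a then 0 else if v == c b then delta else
  if v == c d then rho + delta else (rho + delta) / 2.

Definition triple_map2 v : R :=
  if v == a then rho + delta + r a else if v == b then - r b else
  if v == d then rho + r d else
  if v \in W then
    if e a v && ~~ e b v then r v else if ~~ e a v && ~~ e d v then rho - r v else
    if c v == a then rho + delta else
    if c v == b then if e a v then 0 else rho + delta - r v else
    if c v == d then rho else rho / 2
  else if v == c a then rho + delta else if v == c b then 0 else
  if v == c d then rho else rho / 2.

Let ba : (b == a) = false. Proof. by rewrite eq_sym (negPf ab). Qed.
Let da : (d == a) = false. Proof. by rewrite eq_sym (negPf ad). Qed.
Let db : (d == b) = false. Proof. by rewrite eq_sym (negPf bd). Qed.

Let f1a : triple_map1 a = - r a. Proof. by rewrite /triple_map1 eqxx. Qed.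
Let f1b : triple_map1 b = delta - r b. Proof. by rewrite /triple_map1 ba eqxx. Qed.
Let f1d : triple_map1 d = rho + delta + r d. Proof. by rewrite /triple_map1 da db eqxx. Qed.
Let f2a : triple_map2 a = rho + delta + r a. Proof. by rewrite /triple_map2 eqxx. Qed.
Let f2b : triple_map2 b = - r b. Proof. by rewrite /triple_map2 ba eqxx. Qed.
Let f2d : triple_map2 d = rho + r d. Proof. by rewrite /triple_map2 da db eqxx. Qed.

Let constants : [/\ 1 <= rho, 0 < delta & rho + delta < 5 / 4] /\
  [/\ rho + delta < r a, rho + delta < r b & rho + delta < r d].
Proof.
by split; split; rewrite ?rout ?(lt_le_trans (rout aW) (r54 a)) //;
  [exact: calibrated_rho cal | exact: calibrated_delta cal].
Qed.

Ltac arith := case: constants => -[? ? ?] [? ? ?]; lra.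
Ltac abs_lra := rewrite ?(ltr_norml, ler_norml); apply/andP; split; arith.

Let outW w : w \in W -> out w.
Proof.
move=> wW; rewrite /out; apply/and3P; split; apply: contraTneq wW => ->; [exact: aW|exact: bW|exact: dW].
Qed.

(** The branches of [triple_map1] away from a, b and d, with the consequences for
    the radius; the boolean indices are v \in W, e a v, e b v and e d v. *)
Variant spec1 v : bool -> bool -> bool -> bool -> R -> Type :=
 | T1 of v \in W & ~~ e a v & ~~ e b v : spec1 v true false false (e d v) (delta + r v)
 | S1 of v \in W & ~~ e a v & e b v & c v = b & r v = r b :
     spec1 v true false true (e d v) delta
 | Z1 of v \in W & ~~ e a v & e b v & c v != b : spec1 v true false true (e d v) (r v)
 | U1 of v \in W & e a v & ~~ e d v : spec1 v true true (e b v) false (rho + delta - r v)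
 | Fa1 of v \in W & e a v & e d v & c v = a & r v = r a : spec1 v true true (e b v) true 0
 | Fb1 of v \in W & e a v & e d v & c v = b & r v = r b : spec1 v true true (e b v) true delta
 | Fd1 of v \in W & e a v & e d v & c v = d & r v = r d :
     spec1 v true true (e b v) true (rho + delta)
 | M1 of v \in W & e a v & e d v & c v != a & c v != b & c v != d :
     spec1 v true true (e b v) true ((rho + delta) / 2)
 | Ha1 of v \notin W & v = c a & r v = r a : spec1 v false (e a v) (e b v) (e d v) 0
 | Hb1 of v \notin W & v != c a & v = c b & r v = r b :
     spec1 v false (e a v) (e b v) (e d v) delta
 | Hd1 of v \notin W & v != c a & v != c b & v = c d & r v = r d :
     spec1 v false (e a v) (e b v) (e d v) (rho + delta)
 | P1 of v \notin W & v != c a & v != c b & v != c d & rho + delta < r v :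
     spec1 v false (e a v) (e b v) (e d v) ((rho + delta) / 2).

Lemma spec1P v : out v -> spec1 v (v \in W) (e a v) (e b v) (e d v) (triple_map1 v).
Proof.
move=> /and3P[/negPf va /negPf vb /negPf vd]; rewrite /triple_map1 va vb vd.
have [vW|vW] := boolP (v \in W).
  have [eav|eav] := boolP (e a v).
    have [edv|edv] := boolP (e d v); last exact: U1.
    have [cva|cva] := eqVneq (c v) a; first by apply: Fa1; rewrite // -cva rc.
    have [cvb|cvb] := eqVneq (c v) b; first by apply: Fb1; rewrite // -cvb rc.
    have [cvd|cvd] := eqVneq (c v) d; first by apply: Fd1; rewrite // -cvd rc.
    exact: M1.
  have [ebv|ebv] := boolP (e b v); last exact: T1.
  have [cvb|cvb] := eqVneq (c v) b; first by apply: S1; rewrite // -cvb rc.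
  exact: Z1.
have [vca|vca] := eqVneq v (c a); first by apply: Ha1; rewrite // vca.
have [vcb|vcb] := eqVneq v (c b); first by apply: Hb1; rewrite // vcb.
have [vcd|vcd] := eqVneq v (c d); first by apply: Hd1; rewrite // vcd.
by apply: P1; rewrite ?rout.
Qed.

Let bounds_in1 w : w \in W -> rho + delta - r w <= triple_map1 w <= delta + r w.
Proof.
move=> wW; have ? := r1 w; move: (wW); case: (spec1P (outW wW)) => // *;
  apply/andP; split; arith.
Qed.

Let bounds_out1 v : v \notin W -> out v -> 0 <= triple_map1 v <= rho + delta.
Proof.
by move=> vW ov; move: (vW); case: (spec1P ov) => // *; apply/andP; split; arith.
Qed.

Let center1 v : out v -> `|triple_map1 v - (rho + delta) / 2| < r v.
Proof.
move=> ov; have ? := r1 v; have [/bounds_in1/andP[? ?]|vW] := boolP (v \in W).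
  by abs_lra.
have ? := rout vW; have /andP[? ?] := bounds_out1 vW ov; abs_lra.
Qed.

Let compat1_a v : out v -> e a v -> `|triple_map1 a - triple_map1 v| < r a + r v.
Proof.
move=> ov eav; rewrite f1a; have ? := r1 v.
by move: eav; case: (spec1P ov) => // *; abs_lra.
Qed.

Let compat1_b v : out v -> e b v -> `|triple_map1 b - triple_map1 v| < r b + r v.
Proof.
move=> ov ebv; rewrite f1b; have ? := r1 v.
by move: ebv; case: (spec1P ov) => // *; abs_lra.
Qed.

Let compat1_d v : out v -> e d v -> `|triple_map1 d - triple_map1 v| < r d + r v.
Proof.
move=> ov edv; rewrite f1d; have ? := r1 v.
by move: edv; case: (spec1P ov) => // *; abs_lra.
Qed.

(** This serves both maps: all values other than those at a, b and d are near a
    common point g. *)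
Let compat_from f g : (forall v, out v -> `|f v - g| < r v) ->
  (forall v, out v -> e a v -> `|f a - f v| < r a + r v) ->
  (forall v, out v -> e b v -> `|f b - f v| < r b + r v) ->
  (forall v, out v -> e d v -> `|f d - f v| < r d + r v) -> compatible e r f.
Proof.
move=> center compat_a compat_b compat_d.
have compat u v : out v -> e u v -> `|f u - f v| < r u + r v.
  move=> ov euv; have [ou|] := boolP (out u).
    have := center u ou; have := center v ov.
    by rewrite !ltr_norml => /andP[? ?] /andP[? ?]; abs_lra.
  by rewrite /out !negb_and !negbK => /or3P[] /eqP uE; move: euv; rewrite uE; auto.
move=> u v euv; have [|nov] := boolP (out v); first by move=> ov; apply: compat.
have [ou|nou] := boolP (out u).
  by rewrite distrC [r u + _]addrC; apply: compat; rewrite // e_sym.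
move: nov nou; rewrite /out !negb_and !negbK.
have [nba nda ndb] : [/\ ~~ e b a, ~~ e d a & ~~ e d b] by rewrite ![e _ a]e_sym [e d b]e_sym.
by case/or3P=> /eqP vE /or3P[] /eqP uE; move: euv; rewrite uE vE ?e_irr // => h;
  exfalso; move: h; apply/negP.
Qed.

Lemma triple_map1_compatible : compatible e r triple_map1.
Proof. exact: compat_from center1 compat1_a compat1_b compat1_d. Qed.

Lemma triple_map1_partner w : w \in W -> `|triple_map1 w - triple_map1 (c w)| <= r w.
Proof.
move=> wW; have := adjc wW; have ? := r1 w; have ow := outW wW.
have [? ? ?] := And3 ab ad bd.
have [cwa|cwa] := eqVneq (c w) a.
  rewrite cwa f1a e_sym => eaw; have ? : r w = r a by rewrite -cwa rc.
  by move: (wW) eaw; case: (spec1P ow) => // *; (contra_eq || abs_lra).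
have [cwb|cwb] := eqVneq (c w) b.
  rewrite cwb f1b e_sym => ebw; have ? : r w = r b by rewrite -cwb rc.
  by move: (wW) ebw; case: (spec1P ow) => // *; (contra_eq || abs_lra).
have [cwd|cwd] := eqVneq (c w) d.
  rewrite cwd f1d e_sym => edw; have ? : r w = r d by rewrite -cwd rc.
  by move: (wW) edw; case: (spec1P ow) => // *; (contra_eq || abs_lra).
have ocw : out (c w) by rewrite /out cwa cwb cwd.
move=> _; have ? := rc wW; have /andP[? ?] := bounds_in1 wW.
case/orP: (cW wW) => /andP[cwW ?]; first by have /andP[? ?] := bounds_in1 cwW; abs_lra.
have [cwca|cwca] := eqVneq (c w) (c a).
  have caW : c a \notin W by rewrite -cwca.
  have -> : triple_map1 (c w) = 0.
    by rewrite /triple_map1 (negPf cwa) (negPf cwb) (negPf cwd) (negPf cwW) cwca eqxx.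
  by move: (sibling_a wW caW cwca) (wW); case: (spec1P ow) => // *; (contra_eq || abs_lra).
have /andP[? ?] : delta <= triple_map1 (c w) <= rho + delta.
  by move: (cwW); case: (spec1P ocw) => // *; (contra_eq || (apply/andP; split; arith)).
by abs_lra.
Qed.

Lemma triple_map1_out u v : u \notin W -> v \notin W -> out u -> out v ->
  `|triple_map1 u - triple_map1 v| <= r u.
Proof.
move=> uW vW ou ov; have ? := rout uW.
by have /andP[? ?] := bounds_out1 uW ou; have /andP[? ?] := bounds_out1 vW ov; abs_lra.
Qed.

Let oca : c a \notin W -> out (c a).
Proof.
by move=> caW; rewrite /out; apply/and3P; split; apply: contraTneq adja => ->; rewrite ?e_irr.
Qed.

Let ocb : c b \notin W -> out (c b).
Proof.
move=> cbW; rewrite /out; apply/and3P; split; apply: contraTneq adjb => ->; rewrite ?e_irr //.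
by rewrite e_sym.
Qed.

Let ocd : c d \notin W -> out (c d).
Proof.
move=> cdW; rewrite /out; apply/and3P; split; apply: contraTneq adjd => ->; rewrite ?e_irr //.
  by rewrite e_sym.
by rewrite e_sym.
Qed.

Lemma triple_map1_partner_a : c a \notin W -> `|triple_map1 a - triple_map1 (c a)| <= r a.
Proof.
move=> caW; have /and3P[/negPf va /negPf vb /negPf vd] := oca caW.
by rewrite f1a {1}/triple_map1 va vb vd (negPf caW) eqxx; abs_lra.
Qed.

Lemma triple_map1_partner_b : c b \notin W -> `|triple_map1 b - triple_map1 (c b)| <= r b.
Proof.
move=> cbW; have /and3P[/negPf va /negPf vb /negPf vd] := ocb cbW.
by rewrite f1b {1}/triple_map1 va vb vd (negPf cbW) (negPf (cab cbW)) eqxx; abs_lra.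
Qed.

Lemma triple_map1_partner_d : c d \notin W -> `|triple_map1 d - triple_map1 (c d)| <= r d.
Proof.
move=> cdW; have /and3P[/negPf va /negPf vb /negPf vd] := ocd cdW.
rewrite f1d {1}/triple_map1 va vb vd (negPf cdW) (negPf (cad cdW)) (negPf (cbd cdW)) eqxx.
by abs_lra.
Qed.

Lemma triple_map1_covers_ad : covers r triple_map1 a d.
Proof. by apply: coversl; rewrite f1a f1d; arith. Qed.

Lemma triple_map1_covers_bd : covers r triple_map1 b d.
Proof. by apply: coversl; rewrite f1b f1d; arith. Qed.

Lemma triple_map1_covers_a w : w \in W -> ~~ e a w -> ~~ (e b w && (c w == b)) ->
  covers r triple_map1 a w.
Proof.
move=> wW naw nc; apply: coversl; rewrite f1a.
have [ebw|nbw] := boolP (e b w).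
  have cwb : c w != b by move: nc; rewrite ebw.
  by move: naw ebw (wW); case: (spec1P (outW wW)) => // *; (contra_eq || arith).
by move: naw nbw (wW); case: (spec1P (outW wW)) => // *; arith.
Qed.

Lemma triple_map1_covers_b w : w \in W -> ~~ e a w -> ~~ e b w -> covers r triple_map1 b w.
Proof.
move=> wW naw nbw; apply: coversl; rewrite f1b.
by move: naw nbw (wW); case: (spec1P (outW wW)) => // *; arith.
Qed.

Lemma triple_map1_covers_d w : w \in W -> e a w -> ~~ e d w -> covers r triple_map1 d w.
Proof.
move=> wW eaw ndw; apply: coversr; rewrite f1d.
by move: eaw ndw (wW); case: (spec1P (outW wW)) => // *; arith.
Qed.
Variant spec2 v : bool -> bool -> bool -> bool -> R -> Type :=
 | X2 of v \in W & e a v & ~~ e b v : spec2 v true true false (e d v) (r v)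
 | V2 of v \in W & ~~ e a v & ~~ e d v : spec2 v true false (e b v) false (rho - r v)
 | Fa2 of v \in W & c v = a & r v = r a :
     spec2 v true (e a v) (e b v) (e d v) (rho + delta)
 | Fb2 of v \in W & e a v & c v = b & r v = r b : spec2 v true true (e b v) (e d v) 0
 | Gb2 of v \in W & ~~ e a v & c v = b & r v = r b :
     spec2 v true false (e b v) (e d v) (rho + delta - r v)
 | Fd2 of v \in W & c v = d & r v = r d : spec2 v true (e a v) (e b v) (e d v) rho
 | M2 of v \in W & c v != a & c v != b & c v != d :
     spec2 v true (e a v) (e b v) (e d v) (rho / 2)
 | Ha2 of v \notin W & v = c a & r v = r a :
     spec2 v false (e a v) (e b v) (e d v) (rho + delta)
 | Hb2 of v \notin W & v != c a & v = c b & r v = r b :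
     spec2 v false (e a v) (e b v) (e d v) 0
 | Hd2 of v \notin W & v != c a & v != c b & v = c d & r v = r d :
     spec2 v false (e a v) (e b v) (e d v) rho
 | P2 of v \notin W & v != c a & v != c b & v != c d & rho + delta < r v :
     spec2 v false (e a v) (e b v) (e d v) (rho / 2).

Lemma spec2P v : out v -> spec2 v (v \in W) (e a v) (e b v) (e d v) (triple_map2 v).
Proof.
move=> /and3P[/negPf va /negPf vb /negPf vd]; rewrite /triple_map2 va vb vd.
have [vW|vW] := boolP (v \in W).
  case: ifPn => [/andP[eav ebv]|_]; first by rewrite eav (negPf ebv); apply: X2.
  case: ifPn => [/andP[eav edv]|_]; first by rewrite (negPf eav) (negPf edv); apply: V2.
  have [cva|cva] := eqVneq (c v) a; first by apply: Fa2; rewrite // -cva rc.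
  have [cvb|cvb] := eqVneq (c v) b.
    have rvb : r v = r b by rewrite -cvb rc.
    by have [eav|eav] := boolP (e a v); [apply: Fb2 | apply: Gb2].
  have [cvd|cvd] := eqVneq (c v) d; first by apply: Fd2; rewrite // -cvd rc.
  exact: M2.
have [vca|vca] := eqVneq v (c a); first by apply: Ha2; rewrite // vca.
have [vcb|vcb] := eqVneq v (c b); first by apply: Hb2; rewrite // vcb.
have [vcd|vcd] := eqVneq v (c d); first by apply: Hd2; rewrite // vcd.
by apply: P2; rewrite ?rout.
Qed.

Let bounds_in2 w : w \in W -> rho - r w <= triple_map2 w <= r w.
Proof.
move=> wW; have ? := r1 w; move: (wW); case: (spec2P (outW wW)) => // *;
  apply/andP; split; arith.
Qed.

Let bounds_out2 v : v \notin W -> out v -> 0 <= triple_map2 v <= rho + delta.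
Proof.
by move=> vW ov; move: (vW); case: (spec2P ov) => // *; apply/andP; split; arith.
Qed.

Let center2 v : out v -> `|triple_map2 v - rho / 2| < r v.
Proof.
move=> ov; have ? := r1 v; have [/bounds_in2/andP[? ?]|vW] := boolP (v \in W).
  by abs_lra.
have ? := rout vW; have /andP[? ?] := bounds_out2 vW ov; abs_lra.
Qed.

Let compat2_a v : out v -> e a v -> `|triple_map2 a - triple_map2 v| < r a + r v.
Proof.
move=> ov eav; rewrite f2a; have ? := r1 v.
by move: eav; case: (spec2P ov) => // *; abs_lra.
Qed.

Let compat2_b v : out v -> e b v -> `|triple_map2 b - triple_map2 v| < r b + r v.
Proof.
move=> ov ebv; rewrite f2b; have ? := r1 v.
by move: ebv; case: (spec2P ov) => // *; abs_lra.
Qed.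

Let compat2_d v : out v -> e d v -> `|triple_map2 d - triple_map2 v| < r d + r v.
Proof.
move=> ov edv; rewrite f2d; have ? := r1 v.
by move: edv; case: (spec2P ov) => // *; abs_lra.
Qed.

Lemma triple_map2_compatible : compatible e r triple_map2.
Proof. exact: compat_from center2 compat2_a compat2_b compat2_d. Qed.

Lemma triple_map2_partner w : w \in W -> `|triple_map2 w - triple_map2 (c w)| <= r w.
Proof.
move=> wW; have := adjc wW; have ? := r1 w; have ow := outW wW.
have [? ? ?] := And3 ab ad bd.
have [cwa|cwa] := eqVneq (c w) a.
  rewrite cwa f2a e_sym => eaw; have ? : r w = r a by rewrite -cwa rc.
  by move: (wW) eaw; case: (spec2P ow) => // *; (contra_eq || abs_lra).
have [cwb|cwb] := eqVneq (c w) b.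
  rewrite cwb f2b e_sym => ebw; have ? : r w = r b by rewrite -cwb rc.
  by move: (wW) ebw; case: (spec2P ow) => // *; (contra_eq || abs_lra).
have [cwd|cwd] := eqVneq (c w) d.
  rewrite cwd f2d e_sym => edw; have ? : r w = r d by rewrite -cwd rc.
  by move: (wW) edw; case: (spec2P ow) => // *; (contra_eq || abs_lra).
have ocw : out (c w) by rewrite /out cwa cwb cwd.
move=> _; have ? := rc wW; have /andP[? ?] := bounds_in2 wW.
case/orP: (cW wW) => /andP[cwW ?]; first by have /andP[? ?] := bounds_in2 cwW; abs_lra.
have [cwca|cwca] := eqVneq (c w) (c a).
  have caW : c a \notin W by rewrite -cwca.
  have -> : triple_map2 (c w) = rho + delta.
    by rewrite /triple_map2 (negPf cwa) (negPf cwb) (negPf cwd) (negPf cwW) cwca eqxx.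
  by move: (sibling_a wW caW cwca) (wW); case: (spec2P ow) => // *; (contra_eq || abs_lra).
have /andP[? ?] : 0 <= triple_map2 (c w) <= rho.
  by move: (cwW); case: (spec2P ocw) => // *; (contra_eq || (apply/andP; split; arith)).
by abs_lra.
Qed.

Lemma triple_map2_out u v : u \notin W -> v \notin W -> out u -> out v ->
  `|triple_map2 u - triple_map2 v| <= r u.
Proof.
move=> uW vW ou ov; have ? := rout uW.
by have /andP[? ?] := bounds_out2 uW ou; have /andP[? ?] := bounds_out2 vW ov; abs_lra.
Qed.

Lemma triple_map2_partner_a : c a \notin W -> `|triple_map2 a - triple_map2 (c a)| <= r a.
Proof.
move=> caW; have /and3P[/negPf va /negPf vb /negPf vd] := oca caW.
by rewrite f2a {1}/triple_map2 va vb vd (negPf caW) eqxx; abs_lra.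
Qed.

Let f2cb : c b \notin W -> triple_map2 (c b) = 0.
Proof.
move=> cbW; have /and3P[/negPf va /negPf vb /negPf vd] := ocb cbW.
by rewrite {1}/triple_map2 va vb vd (negPf cbW) (negPf (cab cbW)) eqxx.
Qed.

Lemma triple_map2_partner_b : c b \notin W -> `|triple_map2 b - triple_map2 (c b)| <= r b.
Proof. by move=> cbW; rewrite f2b f2cb //; abs_lra. Qed.

Lemma triple_map2_partner_d : c d \notin W -> `|triple_map2 d - triple_map2 (c d)| <= r d.
Proof.
move=> cdW; have /and3P[/negPf va /negPf vb /negPf vd] := ocd cdW.
rewrite f2d {1}/triple_map2 va vb vd (negPf cdW) (negPf (cad cdW)) (negPf (cbd cdW)) eqxx.
by abs_lra.
Qed.

Lemma triple_map2_covers_ab : covers r triple_map2 a b.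
Proof. by apply: coversr; rewrite f2a f2b; arith. Qed.

Lemma triple_map2_covers_a w : w \in W -> ~~ e a w -> c w = b -> covers r triple_map2 a w.
Proof.
move=> wW naw cwb; apply: coversr; rewrite f2a; have [? ?] := (ab, bd).
by move: naw (wW); case: (spec2P (outW wW)) => // *; (contra_eq || arith).
Qed.

Lemma triple_map2_covers_b w : w \in W -> e a w -> ~~ e b w -> covers r triple_map2 b w.
Proof.
move=> wW naw nbw; apply: coversl; rewrite f2b /triple_map2 naw nbw wW /=.
by have /and3P[/negPf-> /negPf-> /negPf->] := outW wW; arith.
Qed.

Lemma triple_map2_covers_d w : w \in W -> ~~ e a w -> ~~ e d w -> covers r triple_map2 d w.
Proof.
move=> wW naw ndw; apply: coversr; rewrite f2d /triple_map2 (negPf naw) ndw wW /=.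
by have /and3P[/negPf-> /negPf-> /negPf->] := outW wW; arith.
Qed.

Let adj_out v : (e a v || e b v || e d v) -> out v.
Proof.
rewrite /out => h; apply/and3P; split; apply: contraTneq h => ->;
  by rewrite ?e_irr 1?[e b a]e_sym 1?[e d a]e_sym 1?[e d b]e_sym ?(negPf nab) ?(negPf nad) ?(negPf nbd).
Qed.

Lemma triple_separates_b v : e b v -> (v \in W -> r v <= rho) -> separates r triple_map2 b v.
Proof.
move=> ebv low; have ov : out v by apply: adj_out; rewrite ebv orbT.
have ? := r54 v; have ? := r1 v; apply: separatesl; rewrite f2b; move: ebv;
  case: (spec2P ov) => // *; try (assert (r v <= rho) by (apply low; assumption)); arith.
Qed.

Lemma triple_separates_d v : e d v -> (v \in W -> r v <= rho) -> separates r triple_map1 d v.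
Proof.
move=> edv low; have ov : out v by apply: adj_out; rewrite edv !orbT.
have ? := r54 v; have ? := r1 v; apply: separatesr; rewrite f1d; move: edv;
  case: (spec1P ov) => // *; try (assert (r v <= rho) by (apply low; assumption)); arith.
Qed.

Lemma triple_separates_a v : e a v -> (v \in W -> r v <= rho) ->
  separates r triple_map1 a v \/ separates r triple_map2 a v.
Proof.
move=> eav low; have ov : out v by apply: adj_out; rewrite eav.
have ? := r54 v; have ? := r1 v.
(* The partner of b may have a larger radius than a, and in the first coordinate
   it is only delta to the right of the ball of a. *)
have [/andP[vW /eqP vcb]|nvb] := boolP ((v \notin W) && (v == c b)).
  have cbW : c b \notin W by rewrite -vcb.
  by right; apply: separatesr; rewrite f2a vcb f2cb -?vcb //; arith.
have vb : v \notin W -> v != c b by move=> vW; move: nvb; rewrite vW.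
left; apply: separatesl; rewrite f1a; move: eav;
  case: (spec1P ov) => // *; try (assert (r v <= rho) by (apply low; assumption));
  try (assert (v != c b) by (apply vb; assumption); contra_eq); arith.
Qed.
End Triple.

(** * Blocks of coordinates for two or three vertices *)

Section Blocks.
Variables (R : realFieldType) (T : finType) (e : rel T).
Hypotheses (e_sym : symmetric e) (e_irr : irreflexive e).
Variable (r : T -> R).
Implicit Types (gs : seq (T -> R)) (W K : {set T}).

(** What the coordinates gs have to provide for a removed set K when W is the set
    of the vertices placed later: they deal with all pairs that meet K, and are
    harmless for the others. The exception in [block_separates] concerns the
    followers in W whose radius exceeds rho: they are separated from K by the
    coordinates made for W. *)
Record block_maps W (c : T -> T) (rho : R) K gs : Prop := BlockMaps {
  block_compatible : forall g, g \in gs -> compatible e r g;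
  block_partner : forall g w, g \in gs -> w \in W -> `|g w - g (c w)| <= r w;
  block_partner_self : forall g k, g \in gs -> k \in K -> c k \notin W ->
    `|g k - g (c k)| <= r k;
  block_out : forall g u v, g \in gs -> u \notin W -> u \notin K -> v \notin W -> v \notin K ->
    `|g u - g v| <= r u;
  block_covers : forall k v, k \in K -> v \in W :|: K -> v != k -> ~~ e k v ->
    exists2 g, g \in gs & covers r g k v;
  block_separates : forall k v, k \in K -> e k v -> (v \in W -> r v <= rho) ->
    exists2 g, g \in gs & separates r g k v }.

Variables (W : {set T}) (c : T -> T) (rho delta : R).
Hypothesis cal : calibrated e r W c rho delta.

(** Each vertex of W is adjacent to a or to b, so its ball has to avoid at most
    one of their balls. *)
Lemma pair_block a b : placed e r W c a -> placed e r W c b -> ~~ e a b -> a != b ->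
  (c a \notin W -> c a != c b) ->
  (forall w, w \in W -> e a w || e b w) ->
  exists gs, size gs = 1 /\ block_maps W c rho [set a; b] gs.
Proof.
move=> pla plb nab ab cab dom; pose f := pair_map e r W c rho a b.
exists [:: f]; split=> //; have inf : f \in [:: f] by rewrite mem_seq1.
split=> [g|g w|g k|g u v|k v|k v]; rewrite ?mem_seq1.
- by move=> /eqP ->; eapply pair_map_compatible; eauto.
- by move=> /eqP -> wW; eapply pair_map_partner; eauto.
- move=> /eqP ->; rewrite !inE => /orP[] /eqP -> cW'.
    eapply pair_map_partner_a; eauto.
  eapply pair_map_partner_b; eauto.
- move=> /eqP -> uW; rewrite !inE negb_or => /andP[ua ub] vW; rewrite negb_or => /andP[va vb].
  eapply pair_map_out; eauto.
- have cov u w : u \in [set a; b] -> w \in W -> ~~ e u w -> covers r f u w.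
    rewrite !inE => /orP[] /eqP -> wW nuw; first eapply pair_map_covers_a; eauto.
    eapply pair_map_covers_b; eauto => //.
    by have := dom w wW; rewrite (negPf nuw) orbF.
  have covab : covers r f a b by eapply pair_map_covers; eauto.
  move=> kK; rewrite inE => /orP[vW _ nkv|].
    by exists f; rewrite ?cov.
  move: kK; rewrite !inE => /orP[] /eqP -> /orP[] /eqP -> //; rewrite ?eqxx // => _ _;
    exists f => //.
  by rewrite coversC.
- rewrite !inE => /orP[] /eqP -> ekv low; exists f => //.
    eapply pair_map_separates_a; eauto.
  eapply pair_map_separates_b; eauto.
Qed.

Lemma triple_block a b d :
  placed e r W c a -> placed e r W c b -> placed e r W c d ->
  ~~ e a b -> ~~ e a d -> ~~ e b d -> a != b -> a != d -> b != d ->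
  (c b \notin W -> c b != c a) -> (c d \notin W -> c d != c a) ->
  (c d \notin W -> c d != c b) ->
  (forall w, w \in W -> c a \notin W -> c w = c a -> e a w) ->
  exists gs, size gs = 2 /\ block_maps W c rho [set a; b; d] gs.
Proof.
move=> pla plb pld nab nad nbd ab ad bd cab cad cbd sib.
pose f1 := triple_map1 e r W c rho delta a b d.
pose f2 := triple_map2 e r W c rho delta a b d.
exists [:: f1; f2]; split=> //.
have in1 : f1 \in [:: f1; f2] by rewrite !inE eqxx.
have in2 : f2 \in [:: f1; f2] by rewrite !inE eqxx orbT.
split=> [g|g w|g k|g u v|k v|k v]; rewrite ?inE.
- by case/orP=> /eqP->; [eapply triple_map1_compatible; eauto | eapply triple_map2_compatible; eauto].
- by case/orP=> /eqP-> wW; [eapply triple_map1_partner; eauto | eapply triple_map2_partner; eauto].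
- case/orP=> /eqP->; rewrite -orbA => /or3P[] /eqP -> cW'.
  + eapply triple_map1_partner_a; eauto.
  + eapply triple_map1_partner_b; eauto.
  + eapply triple_map1_partner_d; eauto.
  + eapply triple_map2_partner_a; eauto.
  + eapply triple_map2_partner_b; eauto.
  + eapply triple_map2_partner_d; eauto.
- move=> gE uW; rewrite -orbA => /norP[ua /norP[ub ud]] vW; rewrite -orbA => /norP[va /norP[vb vd]].
  have [ou ov] : [&& u != a, u != b & u != d] /\ [&& v != a, v != b & v != d].
    by rewrite ua ub ud va vb vd.
  by case/orP: gE => /eqP->; [eapply triple_map1_out; eauto | eapply triple_map2_out; eauto].
- have covab : covers r f2 a b by eapply triple_map2_covers_ab; eauto.
  have covad : covers r f1 a d by eapply triple_map1_covers_ad; eauto.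
  have covbd : covers r f1 b d by eapply triple_map1_covers_bd; eauto.
  move=> kK vW vk nkv; move: vW; rewrite ?inE => /orP[vW|].
    move: kK nkv; rewrite -orbA => /or3P[] /eqP -> nkv.
    * have [/andP[ebv /eqP cvb]|nc] := boolP (e b v && (c v == b)).
        by exists f2 => //; eapply triple_map2_covers_a; eauto.
      by exists f1 => //; eapply triple_map1_covers_a; eauto.
    * have [eav|nav] := boolP (e a v).
        by exists f2 => //; eapply triple_map2_covers_b; eauto.
      by exists f1 => //; eapply triple_map1_covers_b; eauto.
    * have [eav|nav] := boolP (e a v).
        by exists f1 => //; eapply triple_map1_covers_d; eauto.
      by exists f2 => //; eapply triple_map2_covers_d; eauto.
  move: kK vk; rewrite -!orbA => /or3P[] /eqP -> vk /or3P[] /eqP vE; move: vk; rewrite vE ?eqxx // => _.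
  + by exists f2.
  + by exists f1.
  + by exists f2; rewrite // coversC.
  + by exists f1.
  + by exists f1; rewrite // coversC.
  + by exists f1; rewrite // coversC.
- rewrite -orbA => /or3P[] /eqP -> ekv low.
  + have [] : separates r f1 a v \/ separates r f2 a v by eapply triple_separates_a; eauto.
      by exists f1.
    by exists f2.
  + by exists f2 => //; eapply triple_separates_b; eauto.
  + by exists f1 => //; eapply triple_separates_d; eauto.
Qed.

(** A vertex with its partner outside W may be counted among the followers in W. *)
Lemma calibrated_add x : placed e r W c x -> c x \notin W ->
  (forall w, w \in W -> c w != x) -> calibrated e r (x |: W) c rho delta.
Proof.
move=> /and3P[xW ex /eqP rx] cxW nx; split.
- exact: calibrated_rho cal.
- exact: calibrated_delta cal.
- exact: calibrated_ge1 cal.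
- exact: calibrated_le54 cal.
- by move=> v; rewrite !inE negb_or => /andP[_]; apply: calibrated_out cal v.
- by move=> w /setU1P[->|/(calibrated_adj cal)].
- by move=> w /setU1P[->|/(calibrated_partner cal)].
- move=> w /setU1P[->|wW].
    rewrite !inE negb_or cxW (calibrated_out cal xW) !andbT; apply/orP; right.
    by apply: contraTneq ex => ->; rewrite e_irr.
  by have := calibrated_cases cal wW; rewrite !inE (negPf (nx w wW)).
Qed.

(** The vertices l and m have the same partner, so they cannot be at opposite
    ends. Two pair maps oppose a to l and a to m; in each of them the remaining
    one of l and m is treated as a vertex of W. Since no vertex of W is
    non-adjacent to all three, two coordinates suffice. *)
Lemma sibling_block a l m :
  placed e r W c a -> placed e r W c l -> placed e r W c m ->
  ~~ e a l -> ~~ e a m -> ~~ e l m -> a != l -> a != m -> l != m ->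
  c l \notin W -> c m = c l -> c a != c l ->
  (forall w, w \in W -> c w != l /\ c w != m) ->
  (forall w, w \in W -> [|| e a w, e l w | e m w]) ->
  exists gs, size gs = 2 /\ block_maps W c rho [set a; l; m] gs.
Proof.
move=> pla pll plm nal nam nlm al am lm clW cml cal' nolm dom.
have [[aW ea _] [lW el _] [mW em _]] := And3 (and3P pla) (and3P pll) (and3P plm).
have cmW : c m \notin W by rewrite cml.
have [nla nma nml] : [/\ ~~ e l a, ~~ e m a & ~~ e m l].
  by rewrite [e l a]e_sym [e m a]e_sym [e m l]e_sym.
have [la ma ml] : [/\ l != a, m != a & m != l] by rewrite eq_sym al eq_sym am eq_sym lm.
have cax x : ~~ e a x -> c a != x by move=> nax; apply: contraTneq ea => ->.
have pl_add x y : placed e r W c x -> x != y -> placed e r (y |: W) c x.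
  by move=> /and3P[xW ex rx] xy; rewrite /placed ex rx !inE negb_or xy xW.
have calm : calibrated e r (m |: W) c rho delta.
  by apply: calibrated_add => // w /nolm[].
have call : calibrated e r (l |: W) c rho delta.
  by apply: calibrated_add => // w /nolm[].
have [[pl1 pa1] [pm2 pa2]] := conj (conj (pl_add l m pll lm) (pl_add a m pla am))
  (conj (pl_add m l plm ml) (pl_add a l pla al)).
pose f1 := pair_map e r (m |: W) c rho l a.
pose f2 := pair_map e r (l |: W) c rho m a.
have ne1 : c l \notin m |: W -> c l != c a by rewrite eq_sym.
have ne2 : c m \notin l |: W -> c m != c a by rewrite cml eq_sym.
exists [:: f1; f2]; split=> //.
have in1 : f1 \in [:: f1; f2] by rewrite !inE eqxx.
have in2 : f2 \in [:: f1; f2] by rewrite !inE eqxx orbT.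
have inU x w : w \in W -> w \in x |: W by rewrite inE orbC => ->.
split=> [g|g w|g k|g u v|k v|k v]; rewrite ?inE.
- by case/orP=> /eqP->; [eapply pair_map_compatible; eauto | eapply pair_map_compatible; eauto].
- case/orP=> /eqP-> wW; first by eapply pair_map_partner; eauto; rewrite ?inU.
  by eapply pair_map_partner; eauto; rewrite ?inU.
- have notin1 : c l \notin m |: W.
    by rewrite !inE negb_or clW andbT; apply: contraTneq el => ->.
  have notin2 : c m \notin l |: W.
    by rewrite !inE negb_or cmW andbT; apply: contraTneq em => ->.
  have inm : m \in m |: W by rewrite !inE eqxx.
  have inl : l \in l |: W by rewrite !inE eqxx.
  have notina x : ~~ e a x -> c a \notin W -> c a \notin x |: W.
    by move=> nax caW; rewrite !inE negb_or cax.
  case/orP=> /eqP->; rewrite -orbA => /or3P[] /eqP -> cW'.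
  + by eapply pair_map_partner_b; eauto; rewrite ?notina.
  + eapply pair_map_partner_a; eauto.
  + eapply pair_map_partner; eauto.
  + by eapply pair_map_partner_b; eauto; rewrite ?notina.
  + eapply pair_map_partner; eauto.
  + eapply pair_map_partner_a; eauto.
- move=> gE uW; rewrite -orbA => /norP[ua /norP[ul um]] vW; rewrite -orbA => /norP[va /norP[vl vm]].
  have nU x w : w \notin W -> w != x -> w \notin x |: W by move=> wW wx; rewrite !inE negb_or wx.
  by case/orP: gE => /eqP->; [eapply pair_map_out; eauto | eapply pair_map_out; eauto];
    rewrite ?nU.
- have covla : covers r f1 l a by eapply pair_map_covers; eauto.
  have covma : covers r f2 m a by eapply pair_map_covers; eauto.
  have covlm : covers r f1 l m.
    by eapply pair_map_covers_a; eauto; rewrite // !inE eqxx.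
  move=> kK vW vk nkv; move: vW; rewrite ?inE => /orP[vW|].
    move: kK nkv; rewrite -orbA => /or3P[] /eqP -> nkv.
    * have [elv|nlv] := boolP (e l v).
        by exists f1 => //; eapply pair_map_covers_b; eauto; rewrite ?inU.
      exists f2 => //; eapply pair_map_covers_b; eauto; rewrite ?inU //.
      by have := dom v vW; rewrite (negPf nkv) (negPf nlv).
    * by exists f1 => //; eapply pair_map_covers_a; eauto; rewrite ?inU.
    * by exists f2 => //; eapply pair_map_covers_a; eauto; rewrite ?inU.
  move: kK vk; rewrite -!orbA => /or3P[] /eqP -> vk /or3P[] /eqP vE; move: vk; rewrite vE ?eqxx // => _.
  + by exists f1; rewrite // coversC.
  + by exists f2; rewrite // coversC.
  + by exists f1.
  + by exists f1.
  + by exists f2.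
  + by exists f1; rewrite // coversC.
- have low_add x : ~~ e k x -> e k v -> (v \in W -> r v <= rho) -> v \in x |: W -> r v <= rho.
    by move=> nkx ekv low /setU1P[vx|//]; move: nkx; rewrite -vx ekv.
  rewrite -orbA => /or3P[] /eqP kE ekv low; move: (low_add) ekv; rewrite kE => {}low_add ekv.
  + exists f1 => //; eapply pair_map_separates_b; eauto => //; exact: low_add low.
  + exists f1 => //; eapply pair_map_separates_a; eauto => //; exact: low_add low.
  + exists f2 => //; eapply pair_map_separates_a; eauto => //; exact: low_add low.
Qed.
End Blocks.

(** * Code coordinates when the process stops *)

Ltac abs_lra := rewrite ?(ltr_norml, ler_norml); apply/andP; split; lra.

Section CodeMaps.
Variables (R : realFieldType) (T : finType) (e : rel T) (r : T -> R).
Variables (W H : {set T}) (c : T -> T) (b : T -> bool).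
Hypotheses (r1 : forall v, 1 <= r v) (r54 : forall v, r v <= 5 / 4).

Section Side.
Variables (L : {set T}).
Hypotheses (LW : L \subset W) (L_ind : {in L &, forall l k, ~~ e l k}).
Hypothesis (cL : {in L, forall l, c l \notin W /\ c l \in H}).
Hypothesis (cF : {in W, forall w, w \notin L -> c w \notin L}).

(** A coordinate in which the members of the independent set L are at the two
    ends according to a digit of their code. The other vertices of W are on the
    left and the ones outside W on the right, so that they are separated from L
    by the digits one and zero respectively. The hubs H of L are at 0 in order
    to be at distance r l from l in both cases. *)
Definition side_map v : R :=
  if v \in L then if b v then r v else - r v else
  if v \in W then - (1 / 4) else if v \in H then 0 else 1 / 2.

Let bounds_out v : v \notin L -> - (1 / 4) <= side_map v <= 1 / 2.
Proof.
by move=> /negPf vL; rewrite /side_map vL; case: ifP => _; [|case: ifP => _]; apply/andP; split; lra.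
Qed.

Let bounds_in l : l \in L -> - r l <= side_map l <= r l.
Proof.
move=> lL; rewrite /side_map lL; have ? := r1 l; case: ifP => _; apply/andP; split; lra.
Qed.

Lemma side_map_compatible : compatible e r side_map.
Proof.
move=> u v euv; have [? ?] := (r1 u, r1 v).
have [uL|/bounds_out/andP[? ?]] := boolP (u \in L).
  have [vL|/bounds_out/andP[? ?]] := boolP (v \in L).
    by have := L_ind uL vL; rewrite euv.
  by have /andP[? ?] := bounds_in uL; abs_lra.
have [/bounds_in/andP[? ?]|/bounds_out/andP[? ?]] := boolP (v \in L); abs_lra.
Qed.

Lemma side_map_partner w : w \in W -> `|side_map w - side_map (c w)| <= r w.
Proof.
move=> wW; have ? := r1 w; have [wL|wL] := boolP (w \in L).
  have [cwW cwH] := cL wL; have /andP[? ?] := bounds_in wL.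
  have -> : side_map (c w) = 0.
    by rewrite /side_map (negPf cwW) cwH; case: ifP => // /(subsetP LW); rewrite (negPf cwW).
  by abs_lra.
have /andP[? ?] := bounds_out wL; have /andP[? ?] := bounds_out (cF wW wL); abs_lra.
Qed.

Lemma side_map_out u v : u \notin W -> v \notin W -> `|side_map u - side_map v| <= r u.
Proof.
move=> uW vW; have ? := r1 u.
have nL w : w \notin W -> w \notin L by apply: contra; apply: (subsetP LW).
have /andP[? ?] := bounds_out (nL u uW); have /andP[? ?] := bounds_out (nL v vW); abs_lra.
Qed.

Lemma side_map_covers l k : l \in L -> k \in L -> b l != b k -> covers r side_map l k.
Proof.
move=> lL kL; have [? ?] := (r1 l, r1 k).
case bl : (b l); case bk : (b k) => // _; [apply: coversr | apply: coversl];
  rewrite /side_map lL kL bl bk; lra.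
Qed.

Lemma side_map_separates_out l v : l \in L -> ~~ b l -> v \notin W -> v \notin H ->
  separates r side_map v l.
Proof.
move=> lL /negPf bl vW /negPf vH; have [? ?] := (r1 l, r54 v).
by apply: separatesr; rewrite /side_map lL bl vH (negPf vW) ifN ?(contra (subsetP LW v)) //; lra.
Qed.

Lemma side_map_separates_hub l v : l \in L -> v \notin W -> v \in H -> r v <= r l ->
  separates r side_map v l.
Proof.
move=> lL vW vH rvl; have ? := r1 l.
by case bl : (b l); [apply: separatesl | apply: separatesr];
  rewrite /side_map lL bl vH (negPf vW) (ifN _ _ (contra (subsetP LW v) vW)); lra.
Qed.

Lemma side_map_separates_in l w : l \in L -> b l -> w \in W -> w \notin L ->
  separates r side_map w l.
Proof.
move=> lL bl wW /negPf wL; have [? ?] := (r1 l, r54 w).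
by apply: separatesl; rewrite /side_map lL bl wL wW; lra.
Qed.
End Side.

Section Clique.
Variables (C X : {set T}).
Hypotheses (CW : C \subset W) (XC : X \subset C).
Hypothesis (rX : {in X, forall x, r x = 1 /\ c x \in X}).
Hypothesis (cC : {in C, forall w, w \notin X -> c w \notin W /\ c w \in H}).
Hypothesis (cW : {in W, forall w, w \notin C -> c w \notin W}).

(** A coordinate for codes of pairwise adjacent vertices. No pair has to be
    covered, and all values are within an interval of length 3 / 2, so every
    pair is compatible. A vertex at - r v is separated from everything at
    1 / 4. The vertices of X, which are partners of each other and have radius
    1, use 0 instead of 1 / 4 in order to stay within distance 1. *)
Definition clique_map v : R :=
  if v \in X then if b v then 0 else - 1 else
  if v \in C then if b v then 1 / 4 else - r v else
  if v \in W then 1 / 4 else if v \in H then 0 else 1 / 4.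

Let bounds v : - r v <= clique_map v <= 1 / 4.
Proof.
by have ? := r1 v; rewrite /clique_map; do 5?[case: ifP => _]; apply/andP; split; lra.
Qed.

Let bounds_out v : v \notin C -> 0 <= clique_map v <= 1 / 4.
Proof.
move=> /negPf vC; have vX : v \in X = false by apply: contraFF vC; apply: (subsetP XC).
by rewrite /clique_map vC vX; do 2?[case: ifP => _]; apply/andP; split; lra.
Qed.

Let notW v : v \notin W -> v \notin C.
Proof. by apply: contra; apply: (subsetP CW). Qed.

Let hub_map v : v \notin W -> v \in H -> clique_map v = 0.
Proof.
move=> vW vH; have /negPf vC := notW vW.
have /negPf vX : v \notin X by rewrite (contra (subsetP XC v)) ?vC.
by rewrite /clique_map vX vC (negPf vW) vH.
Qed.

Lemma clique_map_compatible : compatible e r clique_map.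
Proof.
move=> u v _; have [? ?] := (r1 u, r1 v).
by have /andP[? ?] := bounds u; have /andP[? ?] := bounds v; abs_lra.
Qed.

Lemma clique_map_partner w : w \in W -> `|clique_map w - clique_map (c w)| <= r w.
Proof.
move=> wW; have ? := r1 w; have [wX|wX] := boolP (w \in X).
  have [? cX] := rX wX; rewrite /clique_map wX cX.
  by case: ifP => _; case: ifP => _; abs_lra.
have /andP[? ?] := bounds w; have [wC|wC] := boolP (w \in C).
  have [cwW cwH] := cC wC wX; rewrite (hub_map cwW cwH); abs_lra.
have /andP[? ?] := bounds_out wC; have /andP[? ?] := bounds_out (notW (cW wW wC)); abs_lra.
Qed.

Lemma clique_map_out u v : u \notin W -> v \notin W -> `|clique_map u - clique_map v| <= r u.
Proof.
move=> /notW uC /notW vC; have ? := r1 u.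
by have /andP[? ?] := bounds_out uC; have /andP[? ?] := bounds_out vC; abs_lra.
Qed.

Let at_zero w : w \in C -> ~~ b w -> clique_map w = - r w.
Proof.
move=> wC /negPf bw; rewrite /clique_map bw wC; case: ifP => // wX.
by have [-> _] := rX wX.
Qed.

Lemma clique_map_separates_code w v : w \in C -> v \in C -> ~~ b w -> b v ->
  separates r clique_map w v.
Proof.
move=> wC vC bw bv; have [? ? ? ?] := And4 (r1 v) (r1 w) (r54 v) (r54 w).
apply: separatesl; rewrite (at_zero wC bw) /clique_map bv vC; case: ifP => vX;
  rewrite ?(rX vX).1; lra.
Qed.

Lemma clique_map_separates_in w v : w \in C -> ~~ b w -> v \in W -> v \notin C ->
  separates r clique_map w v.
Proof.
move=> wC bw vW /negPf vC; have [? ? ?] := And3 (r1 v) (r1 w) (r54 v).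
have /negPf vX : v \notin X by rewrite (contra (subsetP XC v)) ?vC.
by have ? := r54 w; apply: separatesl; rewrite (at_zero wC bw) /clique_map vX vC vW; lra.
Qed.

Lemma clique_map_separates_out w v : w \in C -> ~~ b w -> v \notin W ->
  (v \in H -> r v <= r w) -> separates r clique_map v w.
Proof.
move=> wC bw vW vH; have [? ? ? ?] := And4 (r1 v) (r1 w) (r54 v) (r54 w).
have [vH'|nvH] := boolP (v \in H).
  by have ? := vH vH'; apply: separatesr; rewrite (at_zero wC bw) hub_map //; lra.
have /negPf vC := notW vW.
have /negPf vX : v \notin X by rewrite (contra (subsetP XC v)) ?vC.
by apply: separatesr; rewrite (at_zero wC bw) /clique_map vX vC (negPf vW) (negPf nvH); lra.
Qed.
End Clique.
End CodeMaps.

(** * States of the process and their placements *)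

Section States.
Variables (R : realFieldType) (T : finType) (e : rel T).
Hypotheses (e_sym : symmetric e) (e_irr : irreflexive e).
Implicit Types (D X K L : {set T}) (hub c : T -> T) (r : T -> R) (u : R)
  (fs : seq (T -> R)).

(** The vertices of W = D :|: X remain to be placed, all others are processed.
    X is the part still covered by edges and cycles. The members of D are the
    followers of processed vertices, at most two for each hub. *)
Record state D X hub : Prop := State {
  state_disjoint : [disjoint D & X];
  state_matchable : two_matchable e X;
  state_hub_out : {in D, forall w, hub w \notin D :|: X};
  state_hub_adj : {in D, forall w, e w (hub w)};
  state_fibre : forall w1 w2 w3, w1 \in D -> w2 \in D -> w3 \in D ->
    hub w1 = hub w2 -> hub w1 = hub w3 -> [|| w1 == w2, w1 == w3 | w2 == w3] }.

(** The radii fixed so far are at least u, and the radii of X will be below u.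
    The radius of a follower is provisional. *)
Record graded D X hub (r0 : T -> R) u : Prop := Graded {
  graded_gt1 : 1 < u;
  graded_ge : forall v, v \notin X -> u <= r0 v;
  graded_le : forall v, v \notin X -> r0 v <= 5 / 4;
  graded_u : u <= 5 / 4;
  graded_hub : {in D, forall w, r0 (hub w) = r0 w} }.

(** The outcome of the process. A follower keeps its provisional radius and has
    its hub as partner, or it gets a radius below u and a partner in D :|: X;
    each hub keeps a follower of the first kind, so that it has a vertex at
    distance equal to its radius. The coordinates fs deal with the pairs inside
    D :|: X. They also separate the followers w of the first kind from adjacent
    processed vertices p; when p is a hub, only those with r p <= r w, because
    hubs may be at distance r w from w. *)
Record placement D X hub (r0 : T -> R) u r c fs : Prop := Placement {
  placement_alive : {in X, forall v, 1 <= r v < u};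
  placement_out : forall v, v \notin D :|: X -> r v = r0 v;
  placement_follower : {in D, forall v, (r v = r0 v /\ c v = hub v) \/ 1 <= r v < u};
  placement_adj : {in D :|: X, forall w, e w (c w)};
  placement_partner : {in D :|: X, forall w, r (c w) = r w};
  placement_low : {in D :|: X, forall w, r w < u -> c w \in D :|: X};
  placement_hub : {in D, forall w, exists w', [/\ w' \in D, hub w' = hub w, r w' = r0 w' & c w' = hub w']};
  placement_compatible : forall f, f \in fs -> compatible e r f;
  placement_short : forall f w, f \in fs -> w \in D :|: X -> `|f w - f (c w)| <= r w;
  placement_short_out : forall f v w, f \in fs -> v \notin D :|: X -> w \notin D :|: X ->
    `|f v - f w| <= r v;
  placement_covers : forall v w, v \in D :|: X -> w \in D :|: X -> v != w -> ~~ e v w ->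
    exists2 f, f \in fs & covers r f v w;
  placement_separates : forall v w, v \in D :|: X -> w \in D :|: X -> e v w ->
    exists2 f, f \in fs & separates r f v w;
  placement_separates_out : forall p w, p \notin D :|: X -> w \in D :|: X -> e p w ->
    u <= r w -> {in D, forall w', hub w' = p -> r p <= r w} ->
    exists2 f, f \in fs & separates r f p w;
  placement_size : (3 * size fs <= 2 * #|D :|: X| + 2)%N }.

Lemma index_enum_lt (A : {set T}) v : v \in A -> (index v (enum A) < #|A|)%N.
Proof. by move=> vA; rewrite cardE index_mem mem_enum. Qed.

Lemma index_enum_inj (A : {set T}) v w : v \in A -> w \in A ->
  index v (enum A) = index w (enum A) -> v = w.
Proof.
move=> vA wA eq; have := congr1 (nth v (enum A)) eq.
by rewrite !nth_index ?mem_enum.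
Qed.

(** The members of L are pairwise non-adjacent and all other pairs in D :|: X are
    adjacent. Codes of length log #|L| in side maps cover the pairs in L; codes
    in clique maps, none of which consists of ones only, separate the other
    vertices from each other, from L and from the processed vertices. *)
Lemma stuck_placement D X hub (r0 : T -> R) u L : state D X hub -> graded D X hub r0 u ->
  L \subset D -> {in L &, forall l k, ~~ e l k} ->
  {in (D :|: X) :\: L, forall v w, w \in D :|: X -> v != w -> e v w} ->
  #|L| != 1%N -> #|L| != 3%N ->
  exists r c fs, placement D X hub r0 u r c fs.
Proof.
move=> st gr LD L_ind F_adj L1 L3; set W := D :|: X; pose F := W :\: L.
have u1 := graded_gt1 gr; have DX := state_disjoint st.
have notX v : v \in D -> v \notin X by move=> vD; rewrite (disjointFr DX vD).
have LW : L \subset W by apply: subset_trans LD (subsetUl _ _).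
have XF : X \subset F.
  apply/subsetP => x xX; rewrite !inE xX orbT andbT.
  by apply: contraL xX => /(subsetP LD); apply: notX.
have WD v : v \in W -> v \notin X -> v \in D by rewrite inE => /orP[] // ->.
pose r v := if v \in X then 1 else r0 v.
pose c v := if v \in D then hub v else odflt v [pick y in X | e v y].
have r1 v : 1 <= r v.
  by rewrite /r; case: ifPn => // /(graded_ge gr) h; apply: ltW (lt_le_trans u1 h).
have r54 v : r v <= 5 / 4 by rewrite /r; case: ifPn => [_|/(graded_le gr)//]; lra.
have rD v : v \in D -> r v = r0 v by move=> /notX /negPf vX; rewrite /r vX.
have rX v : v \in X -> r v = 1 by rewrite /r => ->.
have cD v : v \in D -> c v = hub v by rewrite /c => ->.
have cX v : v \in X -> c v \in X /\ e v (c v).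
  move=> vX; rewrite /c (negPf (contraL (@notX v) vX)); case: pickP => [y /andP[]//|no].
  by have [y yX vy] := two_matchable_nbr (state_matchable st) vX; have := no y; rewrite yX vy.
have hubW v : v \in D -> hub v \notin W by apply: state_hub_out st v.
(* The code of the last vertex of L may have ones only; then side maps do not
   separate it from processed vertices. It is treated in the clique maps too,
   with code zero. *)
pose E := [set l in L | index l (enum L) == #|L|.-1].
pose C := F :|: E.
have CW : C \subset W.
  by rewrite subUset subsetDl (subset_trans _ LW) //; apply/subsetP => l; rewrite inE => /andP[].
have XC : X \subset C by apply: subset_trans XF (subsetUl _ _).
pose HL := [set hub l | l in L]; pose HC := [set hub w | w in D :&: C].
have cL : {in L, forall l, c l \notin W /\ c l \in HL}.
  move=> l lL; have lD := subsetP LD l lL.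
  by rewrite cD //; split; [apply: hubW | apply: imset_f].
have cF : {in W, forall w, w \notin L -> c w \notin L}.
  move=> w wW wL; have [wX|/(WD _ wW) wD] := boolP (w \in X).
    by apply: contraL (cX w wX).1 => /(subsetP LD); apply: notX.
  by rewrite cD // (contra (subsetP LW _)) ?hubW.
have rcX : {in X, forall x, r x = 1 /\ c x \in X}.
  by move=> x xX; rewrite rX //; split; last exact: (cX x xX).1.
have cC : {in C, forall w, w \notin X -> c w \notin W /\ c w \in HC}.
  move=> w wC wX; have wD := WD w (subsetP CW w wC) wX.
  by rewrite cD //; split; [apply: hubW | apply: imset_f; rewrite inE wD].
have cWC : {in W, forall w, w \notin C -> c w \notin W}.
  move=> w wW wC; have wX : w \notin X by apply: contra wC; apply: (subsetP XC).
  by rewrite cD ?hubW ?WD.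
pose k := #|L|; pose m := #|F|.
have k_cases : (k == 0%N) || (1 < k)%N by move: L1; rewrite -/k; case: (k) => [|[]].
pose B1 := up_log 2 k; pose B2 := up_log 2 (maxn m (0 < k)).+1.
pose cd v := if v \in F then index v (enum F) else 0%N.
pose side i := side_map r W HL (fun v => bit (index v (enum L)) i) L.
pose clique i := clique_map r W HC (fun v => bit (cd v) i) C X.
pose fs := mkseq side B1 ++ mkseq clique B2.
have in_side i : (i < B1)%N -> side i \in fs.
  by move=> iB; rewrite mem_cat; apply/orP; left; apply/mapP; exists i; rewrite ?mem_iota.
have in_clique i : (i < B2)%N -> clique i \in fs.
  by move=> iB; rewrite mem_cat; apply/orP; right; apply/mapP; exists i; rewrite ?mem_iota.
have fsP (P : (T -> R) -> Prop) : (forall i, P (side i)) -> (forall i, P (clique i)) ->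
    forall f, f \in fs -> P f.
  by move=> P1 P2 f; rewrite mem_cat => /orP[] /mapP[i _ ->].
have kB1 : (k <= 2 ^ B1)%N by apply: up_logP.
have mB2 : (maxn m (0 < k) < 2 ^ B2)%N by apply: up_logP.
have code_zero v : v \in C -> exists2 i, (i < B2)%N & ~~ bit (cd v) i.
  move=> vC; apply: bit_zero; apply: leq_ltn_trans mB2; rewrite leq_max /cd.
  case: ifPn => vF; first by rewrite index_enum_lt.
  move: vC; rewrite in_setU (negPf vF) inE /= => /andP[vL _]; apply/orP; right.
  by rewrite lt0b card_gt0; apply/set0Pn; exists v.
have side_zero l : l \in L -> l \notin C -> exists2 i, (i < B1)%N & ~~ bit (index l (enum L)) i.
  move=> lL lC; apply: bit_zero; apply: leq_trans kB1; rewrite -/k.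
  have lE : index l (enum L) != k.-1.
    by apply: contra lC => lE; rewrite in_setU [l \in E]inE lL lE orbT.
  by rewrite ltn_neqAle index_enum_lt // andbT; apply: contraNneq lE => kE; rewrite -kE.
exists r, c, fs; split; rewrite -/W.
- by move=> v vX; rewrite rX // lexx.
- by move=> v; rewrite inE negb_or => /andP[_ /negPf vX]; rewrite /r vX.
- by move=> v vD; left; rewrite rD ?cD.
- move=> w wW; have [wX|/(WD _ wW) wD] := boolP (w \in X); first exact: (cX w wX).2.
  by rewrite cD // (state_hub_adj st).
- move=> w wW; have [wX|/(WD _ wW) wD] := boolP (w \in X).
    by rewrite !rX // (cX w wX).1.
  have := hubW w wD; rewrite cD // (rD w wD) in_setU negb_or => /andP[_ /negPf hX].
  by rewrite /r hX (graded_hub gr).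
- move=> w wW; have [wX _|/(WD _ wW) wD] := boolP (w \in X).
    by rewrite inE (cX w wX).1 orbT.
  by rewrite rD // ltNge (graded_ge gr) ?notX.
- by move=> w wD; exists w; rewrite rD ?cD.
- apply: fsP => i; first exact: side_map_compatible.
  exact: clique_map_compatible.
- move=> f w fF wW; move: f fF; apply: fsP => i; first exact: side_map_partner.
  exact: clique_map_partner.
- move=> f v w fF vW wW; move: f fF; apply: fsP => i; first exact: side_map_out.
  exact: clique_map_out.
- move=> v w vW wW vw nvw.
  have vL : v \in L by apply: contraNT nvw => vL; apply: F_adj; rewrite // in_setD vL.
  have wL : w \in L.
    by apply: contraNT nvw => wL; rewrite e_sym; apply: F_adj; rewrite 1?eq_sym // in_setD wL.
  have [|||i iB ib] := @bit_neq B1 (index v (enum L)) (index w (enum L)).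
  + exact: leq_trans (index_enum_lt vL) kB1.
  + exact: leq_trans (index_enum_lt wL) kB1.
  + by apply: contra_neq vw; apply: index_enum_inj.
  by exists (side i); rewrite ?in_side //; apply: side_map_covers.
- have sepFL v l : v \in F -> l \in L -> exists2 f, f \in fs & separates r f v l.
    move=> vF lL; have [vL vW] := setDP vF; have vC : v \in C by rewrite in_setU vF.
    have [lC|lC] := boolP (l \in C).
      have k2 : (1 < k)%N.
        have : (0 < k)%N by rewrite card_gt0; apply/set0Pn; exists l.
        by case/orP: k_cases => // /eqP->.
      have idx : index l (enum L) = k.-1.
        by apply/eqP; move: lC; rewrite in_setU [l \in F]in_setD lL [l \in E]inE lL.
      have [|||i iB ib] := @bit_neq B1 (index l (enum L)) 0.
      + exact: leq_trans (index_enum_lt lL) kB1.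
      + by rewrite expn_gt0.
      + by rewrite idx -lt0n -ltnS prednK // ltnW.
      exists (side i); first exact: in_side.
      apply: side_map_separates_in => //.
      by move: ib; rewrite /bit div0n; case: (odd _).
    have [i iB ib] := code_zero v vC.
    exists (clique i); first exact: in_clique.
    by apply: clique_map_separates_in => //; (exact: rcX || exact: (subsetP LW)).
  move=> v w vW wW evw; have [vL|vL] := boolP (v \in L); have [wL|wL] := boolP (w \in L).
  + by have := L_ind v w vL wL; rewrite evw.
  + have wF : w \in F by rewrite inE wL.
    by have [f fF sep] := sepFL w v wF vL; exists f; rewrite // separatesC.
  + by apply: sepFL; rewrite // in_setD vL.
  + have [vF wF] : v \in F /\ w \in F by rewrite !in_setD vL wL.
    have [vC wC] : v \in C /\ w \in C by split; rewrite in_setU ?vF ?wF.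
    have code_lt x : x \in F -> (cd x < 2 ^ B2)%N.
      move=> xF; apply: leq_trans mB2; rewrite ltnS leq_max /cd xF ltnW // index_enum_lt //.
    have [|||i iB ib] := @bit_neq B2 (cd v) (cd w); [exact: code_lt | exact: code_lt | | ].
      rewrite /cd vF wF; apply: contraTneq evw => /(index_enum_inj vF wF) ->.
      by rewrite e_irr.
    exists (clique i); first exact: in_clique.
    case bv : (bit (cd v) i) ib; case bw : (bit (cd w) i) => // _.
      by rewrite separatesC; apply: clique_map_separates_code; rewrite ?bw //; exact: rcX.
    by apply: clique_map_separates_code; rewrite ?bv //; exact: rcX.
- move=> p w pW wW epw urw hp.
  have wX : w \notin X by apply: contraTN urw => wX; rewrite rX // -ltNge.
  have [wC|wC] := boolP (w \in C).
    have [i iB ib] := code_zero w wC.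
    exists (clique i); first exact: in_clique.
    apply: clique_map_separates_out => //; first exact: rcX.
    move=> /imsetP[w' /setIP[w'D _] pE].
    by apply: hp w'D _.
  have wL : w \in L by apply: contraR wC => wL; rewrite in_setU in_setD wL wW.
  have [i iB ib] := side_zero w wL wC.
  exists (side i); first exact: in_side.
  have [pH|pH] := boolP (p \in HL); last exact: side_map_separates_out.
  apply: side_map_separates_hub => //; have /imsetP[w' w'L pE] := pH.
  by apply: hp (subsetP LD w' w'L) _.
- have kmW : (m + k)%N = #|W|.
    by rewrite -(cardsID L W) (setIidPr LW) addnC.
  by rewrite size_cat !size_mkseq -kmW; apply: up_log2_stuck.
Qed.
End States.

(** * Touching vertices *)

Section Touch.
Variables (R : realFieldType) (T : finType) (e : rel T).
Hypotheses (e_sym : symmetric e) (e_irr : irreflexive e).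
Implicit Types (D X K L : {set T}) (hub c : T -> T) (r : T -> R) (u s : R).

(** The passage from a state to the next one when the independent set K is
    removed: the members of K in X become hubs of radius s, with followers
    taken from X. *)
Record touched D X hub (r0 : T -> R) s K D1 X1 hub1 (r1 : T -> R) : Prop := Touched {
  touched_rest : D1 :|: X1 = (D :|: X) :\: K;
  touched_alive : X1 \subset X;
  touched_follower : D :\: K \subset D1;
  touched_cases : {in D1, forall w, [/\ w \in D, hub1 w = hub w & r1 w = r0 w] \/
                                    [/\ w \in X, hub1 w \in K :&: X & r1 w = s]};
  touched_old : forall v, v \notin X -> r1 v = r0 v;
  touched_new : {in K :&: X, forall k, r1 k = s /\ exists2 w, w \in D1 & hub1 w = k} }.

Lemma touched_graded D X hub (r0 : T -> R) u s K D1 X1 hub1 (r1 : T -> R) u1 :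
  state e D X hub -> graded D X hub r0 u -> touched D X hub r0 s K D1 X1 hub1 r1 ->
  1 < u1 -> u1 <= s -> s <= u -> graded D1 X1 hub1 r1 u1.
Proof.
move=> st gr tc u1_gt1 u1s su; have DX := state_disjoint st.
have r1E v : v \notin X1 -> v \notin X /\ r1 v = r0 v \/ r1 v = s.
  move=> vX1; have [vX|vX] := boolP (v \in X); last by left; rewrite (touched_old tc).
  right; have [vK|vK] := boolP (v \in K).
    by have [|-> _] := touched_new tc (x := v); rewrite ?inE ?vK.
  have : v \in D1 :|: X1 by rewrite (touched_rest tc) !inE vK vX orbT.
  rewrite inE (negPf vX1) orbF => /(touched_cases tc)[[vD _ _]|[_ _ ->//]].
  by rewrite (disjointFr DX vD) in vX.
split=> //.
- move=> v /r1E[[vX ->]|->//].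
  exact: le_trans (le_trans u1s su) (graded_ge gr vX).
- move=> v /r1E[[vX ->]|->]; first exact: (graded_le gr vX).
  exact: le_trans su (graded_u gr).
- exact: le_trans (le_trans u1s su) (graded_u gr).
- move=> w /(touched_cases tc)[[wD -> ->]|[_ /(touched_new tc)[-> _] ->//]].
  rewrite (touched_old tc) ?(graded_hub gr) //.
  by have := state_hub_out st wD; rewrite inE negb_or => /andP[].
Qed.

Lemma pigeonhole2 (F : {set T}) w1 w2 w3 : (#|F| <= 2)%N ->
  w1 \in F -> w2 \in F -> w3 \in F -> [|| w1 == w2, w1 == w3 | w2 == w3].
Proof.
move=> F2 w1F w2F w3F; apply: contraLR F2; rewrite !negb_or => /and3P[w12 w13 w23].
rewrite -ltnNge; have u3 : uniq [:: w1; w2; w3] by rewrite /= !inE negb_or w12 w13 w23.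
apply: (@leq_trans #|[:: w1; w2; w3]|); first by rewrite (card_uniqP u3).
apply: subset_leq_card; apply/subsetP => w.
by rewrite !inE => /or3P[] /eqP->.
Qed.

Lemma touch_one D X hub (r0 : T -> R) s k : state e D X hub -> k \in D :|: X ->
  exists D1 X1 hub1 (r1 : T -> R),
    state e D1 X1 hub1 /\ touched D X hub r0 s [set k] D1 X1 hub1 r1.
Proof.
move=> st; have DX := state_disjoint st; rewrite inE => /orP[kD|kX].
  exists (D :\ k), X, hub, r0; split; split=> //.
  - by apply: disjointWl DX; apply: subD1set.
  - exact: state_matchable st.
  - move=> w /setD1P[_ wD]; have := state_hub_out st wD.
    by apply: contra; apply: (subsetP (setSU _ (subD1set _ _))).
  - by move=> w /setD1P[_ wD]; apply: state_hub_adj st _ wD.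
  - move=> w1 w2 w3 /setD1P[_ w1D] /setD1P[_ w2D] /setD1P[_ w3D].
    exact: state_fibre st _ _ _ w1D w2D w3D.
  - apply/setP => v; rewrite !inE; have [->|//] := eqVneq v k.
    by rewrite (disjointFr DX kD).
  - by move=> w /setD1P[_ wD]; left.
  - by move=> v; rewrite !inE => /andP[/eqP-> kX]; rewrite (disjointFr DX kD) in kX.
have [F [FX F0 F2 Fk alive]] := two_matchable_touch e_sym e_irr (state_matchable st) kX.
have kF : k \notin F by apply/negP => /Fk; rewrite e_irr.
have FD w : w \in F -> w \notin D by move=> /(subsetP FX) wX; rewrite (disjointFl DX wX).
pose hub1 w := if w \in F then k else hub w.
pose r1 v := if (v \in F) || (v == k) then s else r0 v.
have hub1D w : w \in D -> hub1 w = hub w.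
  by rewrite /hub1; case: ifP => // /FD /negPf->.
have hub1F w : w \in F -> hub1 w = k by rewrite /hub1 => ->.
have D1X1 : (D :|: F) :|: (X :\ k) :\: F = (D :|: X) :\: [set k].
  apply/setP => v; rewrite !inE; have [->|vk] := eqVneq v k.
    by rewrite (disjointFl DX kX) (negPf kF).
  have [vF|vF] := boolP (v \in F); first by rewrite (subsetP FX v vF) !orbT.
  by rewrite orbF.
exists (D :|: F), ((X :\ k) :\: F), hub1, r1; split; split=> //.
- rewrite disjoints_subset; apply/subsetP => v; rewrite !inE.
  by case/orP=> [vD|->//]; rewrite (disjointFr DX vD) !andbF.
- move=> w; rewrite D1X1 inE => /orP[wD|wF]; last by rewrite hub1F // !inE eqxx.
  by rewrite hub1D // inE negb_and (state_hub_out st) ?orbT.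
- move=> w; rewrite inE => /orP[wD|wF]; first by rewrite hub1D // (state_hub_adj st).
  by rewrite hub1F // e_sym Fk.
- have hubk w : w \in D -> hub w != k.
    by move=> wD; apply: contraNneq (state_hub_out st wD) => ->; rewrite inE kX orbT.
  move=> w1 w2 w3; rewrite !(in_setU _ D).
  case/orP=> w1D; case/orP=> w2D; case/orP=> w3D; rewrite ?(hub1D _ w1D) ?(hub1F _ w1D)
    ?(hub1D _ w2D) ?(hub1F _ w2D) ?(hub1D _ w3D) ?(hub1F _ w3D) => e12 e13.
  + exact: state_fibre st _ _ _ w1D w2D w3D e12 e13.
  + by have := hubk _ w1D; rewrite e13 eqxx.
  + by have := hubk _ w1D; rewrite e12 eqxx.
  + by have := hubk _ w1D; rewrite e12 eqxx.
  + by have := hubk _ w2D; rewrite -e12 eqxx.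
  + by have := hubk _ w2D; rewrite -e12 eqxx.
  + by have := hubk _ w3D; rewrite -e13 eqxx.
  + exact: pigeonhole2 F2 w1D w2D w3D.
- by apply: subset_trans (subsetDl _ _) (subD1set _ _).
- by apply: subset_trans (subsetDl _ _) (subsetUl _ _).
- move=> w; rewrite inE => /orP[wD|wF].
    left; split=> //; first exact: hub1D.
    rewrite /r1 ifN // negb_or; apply/andP; split.
      by apply: contraL wD; apply: FD.
    by apply: contraTneq wD => ->; rewrite (disjointFl DX kX).
  by right; rewrite hub1F // /r1 wF (subsetP FX) // !inE eqxx kX.
- move=> v vX; rewrite /r1 ifN // negb_or; apply/andP; split.
    by apply: contra vX; apply: (subsetP FX).
  by apply: contraNneq vX => ->.
- move=> v; rewrite !inE => /andP[/eqP -> _]; split; first by rewrite /r1 eqxx orbT.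
  by have /set0Pn[w wF] := F0; exists w; rewrite ?hub1F // inE wF orbT.
Qed.

(** The members of K are touched one after the other. As K is independent, none
    of them becomes a follower of another one, so each is still in X when its
    turn comes. *)
Lemma touch_seq D X hub (r0 : T -> R) s (ks : seq T) : state e D X hub -> uniq ks ->
  {subset ks <= D :|: X} -> {in ks &, forall k l, ~~ e k l} ->
  exists D1 X1 hub1 (r1 : T -> R),
    state e D1 X1 hub1 /\ touched D X hub r0 s [set k in ks] D1 X1 hub1 r1.
Proof.
move=> st; elim: ks => [_ _ _|k ks IH /= /andP[kks uks] ksW ind].
  exists D, X, hub, r0; split=> //; have -> : [set k in [::]] = set0 :> {set T}.
    by apply/setP => v; rewrite !inE.
  split=> //; rewrite ?setD0 //.
  - by move=> w wD; left.
  - by move=> v; rewrite !inE.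
have [||D1 [X1 [hub1 [r1 [st1 tc1]]]]] := IH uks.
- by move=> l lks; apply: ksW; rewrite inE lks orbT.
- by move=> l m lks mks; apply: ind; rewrite inE ?lks ?mks orbT.
have DX := state_disjoint st; have DX1 := state_disjoint st1.
have kW1 : k \in D1 :|: X1.
  by rewrite (touched_rest tc1) !inE kks -in_setU ksW ?mem_head.
have kind l : l \in ks -> ~~ e l k by move=> lks; apply: ind; rewrite !inE ?eqxx ?lks ?orbT.
have [D2 [X2 [hub2 [r2 [st2 tc2]]]]] := touch_one r1 s st1 kW1.
exists D2, X2, hub2, r2; split=> //.
have setE : [set l in k :: ks] = k |: [set l in ks] by apply/setP => l; rewrite !inE.
have kX : k \in X -> k \in X1.
  move=> kX; move: kW1; rewrite inE => /orP[kD1|//].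
  case: (touched_cases tc1 kD1) => [[kD _ _]|[_]]; first by rewrite (disjointFr DX kD) in kX.
  rewrite !inE => /andP[hk _] _; have := state_hub_adj st1 kD1.
  by rewrite e_sym (negPf (kind _ hk)).
split; rewrite ?setE.
- by rewrite (touched_rest tc2) (touched_rest tc1) setDDl [[set k] :|: _]setUC.
- exact: subset_trans (touched_alive tc2) (touched_alive tc1).
- apply/subsetP => v; rewrite !inE negb_or => /andP[/andP[vk vks] vD].
  apply: (subsetP (touched_follower tc2)); rewrite !inE vk.
  by apply: (subsetP (touched_follower tc1)); rewrite !inE vks.
- move=> w /(touched_cases tc2)[[wD1 -> ->]|[wX1]].
    case: (touched_cases tc1 wD1) => [?|[wX]]; first by left.
    by rewrite !inE => /andP[-> ->] ->; right; rewrite orbT.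
  rewrite !inE => /andP[/eqP-> kX1] ->; right; rewrite eqxx !(subsetP (touched_alive tc1)) //.
- move=> v vX; rewrite (touched_old tc2) ?(touched_old tc1) //.
  by apply: contra vX; apply: (subsetP (touched_alive tc1)).
- move=> l; rewrite !inE => /andP[/orP[/eqP->|lks] lX].
    by apply: (touched_new tc2); rewrite !inE eqxx kX.
  have [|lr [w wD1 wl]] := touched_new tc1 (x := l); first by rewrite !inE lks.
  have lX1 : l \notin X1.
    have : l \notin D1 :|: X1 by rewrite (touched_rest tc1) !inE lks.
    by rewrite inE negb_or => /andP[].
  split; first by rewrite (touched_old tc2).
  have wD2 : w \in D2.
    apply: (subsetP (touched_follower tc2)); rewrite !inE wD1 andbT.
    have := state_hub_adj st1 wD1; rewrite wl.
    by apply: contraTneq => ->; rewrite e_sym kind.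
  exists w => //; case: (touched_cases tc2 wD2) => [[_ -> _]//|[wX1 _ _]].
  by rewrite (disjointFr DX1 wD1) in wX1.
Qed.
End Touch.

(** * Extending a placement by a block *)

Section Extend.
Variables (R : realFieldType) (T : finType) (e : rel T).
Hypotheses (e_sym : symmetric e) (e_irr : irreflexive e).
Variables (D X K D1 X1 : {set T}) (hub hub1 : T -> T) (r0 r1 : T -> R) (s u u1 delta : R).
Hypotheses (st : state e D X hub) (gr : graded D X hub r0 u) (KW : K \subset D :|: X).
Hypotheses (st1 : state e D1 X1 hub1) (tc : touched D X hub r0 s K D1 X1 hub1 r1).
Hypotheses (u1_gt1 : 1 < u1) (delta0 : 0 < delta) (u1s : u1 + delta < s) (su : s < u).
Variables (r : T -> R) (c1 : T -> T) (fs : seq (T -> R)).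
Hypothesis pl : placement e D1 X1 hub1 r1 u1 r c1 fs.

Let DX := state_disjoint st.
Let rest := touched_rest tc.

Let u1_lt_s : u1 < s. Proof. by apply: lt_trans u1s; rewrite ltrDl. Qed.
Let gr1 : graded D1 X1 hub1 r1 u1.
Proof. by apply: touched_graded st gr tc u1_gt1 _ _; apply: ltW. Qed.

Let K_rest k : k \in K -> k \notin D1 :|: X1.
Proof. by move=> kK; rewrite rest !inE kK. Qed.

Let restP v : (v \in D1 :|: X1) = (v \notin K) && (v \in D :|: X).
Proof. by rewrite rest in_setD. Qed.

Let sub_rest v : v \in D1 :|: X1 -> v \in D :|: X.
Proof. by rewrite restP => /andP[]. Qed.

Let rest_or v : v \in D :|: X -> v \in K \/ v \in D1 :|: X1.
Proof. by move=> vW; rewrite restP vW andbT; case: (v \in K); [left | right]. Qed.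

Let notX v : v \in D -> v \notin X. Proof. by move=> vD; rewrite (disjointFr DX vD). Qed.

Let hub_out w : w \in D -> hub w \notin D :|: X. Proof. exact: (state_hub_out st). Qed.

Let rKX k : k \in K -> k \in X -> r k = s.
Proof.
move=> kK kX; rewrite (placement_out pl) ?K_rest //.
by have [|-> _] := touched_new tc (x := k); rewrite ?inE ?kK.
Qed.

Let r_old v : v \notin D1 :|: X1 -> v \notin X -> r v = r0 v.
Proof. by move=> vW vX; rewrite (placement_out pl) // (touched_old tc). Qed.

(* A vertex whose radius was not lowered later is a follower that kept its hub. *)
Let kept w : w \in D1 :|: X1 -> u1 <= r w ->
  [/\ w \in D1, r w = r1 w & c1 w = hub1 w].
Proof.
rewrite inE => /orP[wD1|/(placement_alive pl)/andP[_]]; last by rewrite ltNge => /negPf->.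
case: (placement_follower pl wD1) => [[-> ->]//|/andP[_]].
by rewrite ltNge => /negPf->.
Qed.

Let r1_kept w : w \in D1 -> s <= r1 w.
Proof.
case/(touched_cases tc)=> [[wD _ ->]|[_ _ ->]//].
by rewrite ltW // (lt_le_trans su) // (graded_ge gr) ?notX.
Qed.

(** A touched vertex has as partner a follower that kept it as partner. *)
Definition extended_partner v : T :=
  if v \in K then if v \in D then hub v else
    odflt v [pick w in D1 | (hub1 w == v) && (r w == r1 w) && (c1 w == v)]
  else c1 v.
Local Notation c := extended_partner.

Lemma extended_partner_follower k : k \in K -> k \in D -> c k = hub k.
Proof. by rewrite /c => -> ->. Qed.

Lemma extended_partner_rest w : w \in D1 :|: X1 -> c w = c1 w.
Proof. by rewrite restP /c => /andP[/negPf->]. Qed.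

Lemma extended_partner_alive k : k \in K -> k \in X ->
  [/\ c k \in D1, hub1 (c k) = k, r (c k) = s & c (c k) = k].
Proof.
move=> kK kX; have kD : k \in D = false by apply: contraTF kX => /notX.
have [|_ [w wD1 wk]] := touched_new tc (x := k); first by rewrite inE kK.
have [w' [w'D1 w'k rw' cw']] := placement_hub pl wD1.
rewrite /c kK kD; case: pickP => [v /andP[vD1 /andP[/andP[/eqP hv /eqP rv] /eqP cv]]|no]; last first.
  by have := no w'; rewrite w'D1 rw' cw' w'k wk !eqxx.
rewrite /=; have vW : v \in D1 :|: X1 by rewrite inE vD1.
split=> //; last by move: vW; rewrite restP => /andP[/negPf-> _].
rewrite rv; case: (touched_cases tc vD1) => [[vD hE _]|[_ _ ->]//].
by have := hub_out vD; rewrite -hE hv inE kX orbT.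
Qed.

Lemma extended_calibrated : calibrated e r (D1 :|: X1) c u1 delta.
Proof.
have out v : v \notin D1 :|: X1 -> u1 + delta < r v.
  move=> vW; rewrite (placement_out pl) //; have [vX|vX] := boolP (v \in X); last first.
    by rewrite (touched_old tc) // (lt_le_trans (lt_trans u1s su)) ?(graded_ge gr).
  have vK : v \in K by move: vW; rewrite restP [v \in _ :|: _]inE vX orbT andbT negbK.
  by have [|-> _] := touched_new tc (x := v); rewrite ?inE ?vK.
have r_cases v : v \in D1 :|: X1 -> 1 <= r v < u1 \/ s <= r v <= 5 / 4.
  rewrite inE => /orP[vD1|/(placement_alive pl)]; last by left.
  case: (placement_follower pl vD1) => [[-> _]|]; last by left.
  right; rewrite r1_kept // (graded_le gr1) //.
  by rewrite (disjointFr (state_disjoint st1) vD1).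
have u154 := graded_u gr1.
split.
- exact: ltW.
- exact: delta0.
- move=> v; have [/r_cases[/andP[]//|/andP[sv _]]|/out h] := boolP (v \in D1 :|: X1).
    by apply: le_trans sv; apply: ltW; apply: lt_trans u1_lt_s.
  by apply: ltW; apply: lt_trans h; rewrite ltr_wpDr // ltW.
- move=> v; have [/r_cases[/andP[_ vu]|/andP[]//]|vW] := boolP (v \in D1 :|: X1).
    by apply: le_trans u154; apply: ltW.
  rewrite (placement_out pl) // (graded_le gr1) //.
  by move: vW; rewrite inE negb_or => /andP[].
- exact: out.
- by move=> w wW; rewrite extended_partner_rest // (placement_adj pl).
- by move=> w wW; rewrite extended_partner_rest // (placement_partner pl).
- move=> w wW; rewrite extended_partner_rest //; have [low|high] := ltP (r w) u1.
    by rewrite (placement_low pl) // ltW.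
  have [wD1 rw ->] := kept wW high; rewrite (state_hub_out st1 wD1) rw (lt_le_trans u1s (r1_kept wD1)).
  by rewrite orbT.
Qed.

Lemma extended_placed k : k \in K -> placed e r (D1 :|: X1) c k.
Proof.
move=> kK; rewrite /placed K_rest //=; have := subsetP KW k kK.
rewrite inE => /orP[kD|kX].
  rewrite extended_partner_follower // (state_hub_adj st kD) /=.
  have hW := hub_out kD; rewrite (r_old (K_rest kK)) ?notX // r_old ?(graded_hub gr) //.
    by apply: contra hW; apply: sub_rest.
  by move: hW; rewrite inE negb_or => /andP[].
have [cD1 hc rc _] := extended_partner_alive kK kX.
by rewrite rc rKX // eqxx andbT -{1}hc e_sym (state_hub_adj st1).
Qed.

Lemma extended_hub w : w \in D1 :|: X1 -> c w \notin D1 :|: X1 -> w \in D1 /\ c w = hub1 w.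
Proof.
move=> wW; rewrite extended_partner_rest // => cW.
have [low|high] := ltP (r w) u1; first by rewrite (placement_low pl) in cW.
by have [wD1 _ ->] := kept wW high.
Qed.

(** Pairs that meet K are dealt with by gs, except for the neighbours in D1 :|: X1
    of radius above u1. These are followers of processed vertices, and the given
    placement separates them from all processed vertices, hence from K. *)
Lemma placement_extend gs : block_maps e r (D1 :|: X1) c u1 K gs ->
  (3 * size gs <= 2 * #|K|)%N -> placement e D X hub r0 u r c (gs ++ fs).
Proof.
move=> bl gs_size.
have in_gs g : g \in gs -> g \in gs ++ fs by rewrite mem_cat => ->.
have in_fs g : g \in fs -> g \in gs ++ fs by rewrite mem_cat orbC => ->.
have cK k : k \in K -> c k \in D1 :|: X1 -> c (c k) = k /\ r (c k) = r k.
  move=> kK; have := subsetP KW k kK; rewrite [k \in _]inE => /orP[kD|kX].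
    by rewrite extended_partner_follower // => /sub_rest; rewrite (negPf (hub_out kD)).
  by have [_ _ rc cc] := extended_partner_alive kK kX; rewrite rc cc rKX.
have sepK k w : k \in K -> w \in D :|: X -> e k w -> exists2 f, f \in gs ++ fs & separates r f k w.
  move=> kK wW ekw; have [low|high] := boolP ((w \in D1 :|: X1) ==> (r w <= u1)).
    have [f fgs sep] := block_separates bl kK ekw (implyP low).
    by exists f => //; apply: in_gs.
  move: high; rewrite negb_imply -ltNge => /andP[wW1 high].
  have [wD1 rw cw] := kept wW1 (ltW high).
  have [|f ffs sep] := placement_separates_out pl (K_rest kK) wW1 ekw (ltW high).
    move=> w' w'D1 hw'; case: (touched_cases tc w'D1) => [[w'D hE _]|[_]].
      by have := hub_out w'D; rewrite -hE hw' (subsetP KW).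
    by rewrite hw' inE => /andP[_ kX] _; rewrite rKX // rw r1_kept.
  by exists f => //; apply: in_fs.
split.
- move=> v vX; have vWX : v \in D :|: X by rewrite inE vX orbT.
  case: (rest_or vWX) => [vK|vW].
    by rewrite rKX // su andbT; apply: ltW; apply: lt_trans u1_lt_s.
  have [low|high] := ltP (r v) u1.
    rewrite (lt_trans low) ?(lt_trans u1_lt_s) // andbT.
    exact: (calibrated_ge1 extended_calibrated).
  have [vD1 -> _] := kept vW high.
  have -> : r1 v = s by case: (touched_cases tc vD1) => [[/notX]|[]//]; rewrite vX.
  by rewrite su andbT; apply: ltW; apply: lt_trans u1_lt_s.
- move=> v vW; apply: r_old; first by apply: contra vW; apply: sub_rest.
  by move: vW; rewrite inE negb_or => /andP[].
- move=> v vD; have vWX : v \in D :|: X by rewrite inE vD.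
  case: (rest_or vWX) => [vK|vW].
    by left; rewrite r_old ?K_rest ?notX // extended_partner_follower.
  have [low|high] := ltP (r v) u1.
    right; rewrite (lt_trans low) ?(lt_trans u1_lt_s) // andbT.
    exact: (calibrated_ge1 extended_calibrated).
  left; rewrite extended_partner_rest //; have [vD1 -> ->] := kept vW high.
  by case: (touched_cases tc vD1) => [[_ -> ->]|[vX]] //; rewrite (negPf (notX vD)) in vX.
- move=> w /rest_or[wK|wW]; first by case/and3P: (extended_placed wK).
  exact: (calibrated_adj extended_calibrated).
- move=> w /rest_or[wK|wW]; first by case/and3P: (extended_placed wK) => _ _ /eqP.
  exact: (calibrated_partner extended_calibrated).
- move=> w wW low; case: (rest_or wW) => [wK|wW1].
    move: (wW); rewrite inE => /orP[wD|wX].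
      by move: low; rewrite r_old ?K_rest ?notX // ltNge (graded_ge gr) ?notX.
    by have [cD1 _ _ _] := extended_partner_alive wK wX; apply: sub_rest; rewrite inE cD1.
  have [cW|cW] := boolP (c w \in D1 :|: X1); first exact: sub_rest.
  have [wD1 ->] := extended_hub wW1 cW.
  case: (touched_cases tc wD1) => [[wD _ rw]|[_]]; last first.
    by rewrite inE => /andP[hK _] _; apply: (subsetP KW).
  have [low1|high] := ltP (r w) u1.
    by move: cW; rewrite extended_partner_rest // (placement_low pl).
  have [_ rE _] := kept wW1 high.
  by move: low; rewrite rE rw ltNge (graded_ge gr) ?notX.
- move=> w wD; have wWX : w \in D :|: X by rewrite inE wD.
  case: (rest_or wWX) => [wK|wW].
    by exists w; rewrite r_old ?K_rest ?notX // extended_partner_follower.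
  have wD1 : w \in D1.
    apply: (subsetP (touched_follower tc)); rewrite inE wD andbT.
    by move: wW; rewrite restP => /andP[].
  have hw : hub1 w = hub w.
    by case: (touched_cases tc wD1) => [[]//|[wX]]; rewrite (negPf (notX wD)) in wX.
  have [w' [w'D1 h' r' c']] := placement_hub pl wD1.
  have w'W : w' \in D1 :|: X1 by rewrite inE w'D1.
  case: (touched_cases tc w'D1) => [[w'D hE rE]|[_]].
    by exists w'; rewrite extended_partner_rest // c' r' rE -hE h' hw.
  by rewrite h' hw inE => /andP[/(subsetP KW)]; rewrite (negPf (hub_out wD)).
- by move=> f; rewrite mem_cat => /orP[/(block_compatible bl)|/(placement_compatible pl)].
- move=> f w; rewrite mem_cat => fE /rest_or[wK|wW]; last first.
    case/orP: fE => fE; first exact: (block_partner bl).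
    by rewrite extended_partner_rest // (placement_short pl).
  have [cW|cW] := boolP (c w \in D1 :|: X1).
    have [cc rc] := cK w wK cW; rewrite distrC -rc.
    case/orP: fE => fE; first by have := block_partner bl fE cW; rewrite cc.
    by have := placement_short pl fE cW; rewrite -extended_partner_rest // cc.
  case/orP: fE => fE; first exact: (block_partner_self bl).
  by apply: (placement_short_out pl) => //; apply: K_rest.
- move=> f v w; rewrite mem_cat => /orP[] fE vW wW.
    apply: (block_out bl) => //.
    + by apply: contra vW; apply: sub_rest.
    + by apply: contra vW; apply: (subsetP KW).
    + by apply: contra wW; apply: sub_rest.
    + by apply: contra wW; apply: (subsetP KW).
  by apply: (placement_short_out pl) => //; [apply: contra vW | apply: contra wW]; apply: sub_rest.
- have inWK w : w \in D :|: X -> w \in (D1 :|: X1) :|: K.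
    by case/rest_or => h; rewrite in_setU h ?orbT.
  move=> v w vW wW vw nvw; case: (rest_or vW) => [vK|vW1].
    have [|f fgs cov] := block_covers bl vK (inWK w wW) _ nvw; first by rewrite eq_sym.
    by exists f => //; apply: in_gs.
  case: (rest_or wW) => [wK|wW1].
    have [|f fgs cov] := block_covers bl wK (inWK v vW) vw; first by rewrite e_sym.
    by exists f; rewrite 1?coversC //; apply: in_gs.
  have [f ffs cov] := placement_covers pl vW1 wW1 vw nvw.
  by exists f => //; apply: in_fs.
- move=> v w vW wW evw; case: (rest_or vW) => [vK|vW1]; first exact: sepK.
  case: (rest_or wW) => [wK|wW1].
    by have [|f fE sep] := sepK w v wK vW; [rewrite e_sym | exists f; rewrite // separatesC].
  have [f ffs sep] := placement_separates pl vW1 wW1 evw.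
  by exists f => //; apply: in_fs.
- move=> p w pW wW epw urw hp; have pW1 : p \notin D1 :|: X1.
    by apply: contra pW; apply: sub_rest.
  case: (rest_or wW) => [wK|wW1].
    have ewp : e w p by rewrite e_sym.
    have low : p \in D1 :|: X1 -> r p <= u1 by move=> pW2; rewrite pW2 in pW1.
    have [f fgs sep] := block_separates bl wK ewp low.
    by exists f; rewrite 1?separatesC //; apply: in_gs.
  have [||f ffs sep] := placement_separates_out pl pW1 wW1 epw.
  + by apply: le_trans urw; apply: ltW; apply: lt_trans su.
  + move=> w' w'D1 hw'; case: (touched_cases tc w'D1) => [[w'D hE _]|[_]].
      by apply: (hp w' w'D); rewrite -hE.
    by rewrite hw' inE => /andP[/(subsetP KW)]; rewrite (negPf pW).
  + by exists f => //; apply: in_fs.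
- have -> : #|D :|: X| = (#|K| + #|D1 :|: X1|)%N.
    by rewrite -(cardsID K (D :|: X)) rest (setIidPr KW).
  rewrite size_cat mulnDr mulnDr -addnA; exact: leq_add gs_size (placement_size pl).
Qed.
End Extend.

(** * Steps that remove vertices *)

Section Steps.
Variables (R : realFieldType) (T : finType) (e : rel T).
Hypotheses (e_sym : symmetric e) (e_irr : irreflexive e).
Implicit Types (D X K L : {set T}) (hub c : T -> T) (r : T -> R) (u : R).

Definition placeable D X hub (r0 : T -> R) u := exists r c fs, placement e D X hub r0 u r c fs.

Section Step.
Variables (D X : {set T}) (hub : T -> T) (r0 : T -> R) (u : R).
Hypotheses (st : state e D X hub) (gr : graded D X hub r0 u).
Let W := D :|: X.
Hypothesis IH : forall D1 X1 hub1 (r1 : T -> R) u1, state e D1 X1 hub1 ->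
  graded D1 X1 hub1 r1 u1 -> (#|D1 :|: X1| < #|W|)%N -> placeable D1 X1 hub1 r1 u1.

Let DX := state_disjoint st.
Let hub_out w : w \in D -> hub w \notin W. Proof. exact: (state_hub_out st). Qed.
Let WP v : v \in W -> (v \in D) || (v \in X). Proof. by rewrite inE. Qed.

(** What is known of a placement of W1 = W :\: K, obtained by recursion, when the
    block for K is chosen. *)
Record step K W1 c r rho delta : Prop := Step {
  step_rest : W1 = W :\: K;
  step_calibrated : calibrated e r W1 c rho delta;
  step_placed : {in K, forall k, placed e r W1 c k};
  step_hub : {in K, forall k, k \in D -> c k = hub k};
  step_alive : {in K, forall k, k \in X -> c k \in W1};
  step_cases : {in W1, forall w, c w \notin W1 ->
    (w \in D) && (c w == hub w) || (c w \in K :&: X)};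
  step_extend : forall gs, block_maps e r W1 c rho K gs -> (3 * size gs <= 2 * #|K|)%N ->
    placeable D X hub r0 u }.

Lemma step_exists K : K != set0 -> K \subset W -> {in K &, forall k l, ~~ e k l} ->
  exists W1 c r rho delta, step K W1 c r rho delta.
Proof.
move=> K0 KW ind; have u_gt1 := graded_gt1 gr.
(* The touched vertices and their followers get radius s, smaller than all
   radii chosen before; the radii chosen later are below u1. *)
pose s := (1 + u) / 2; pose u1 := (3 + u) / 4; pose delta := (u - 1) / 8.
have [u1_gt1 delta0 u1s su] : [/\ 1 < u1, 0 < delta, u1 + delta < s & s < u].
  by rewrite /u1 /delta /s; split; lra.
have [||D1 [X1 [hub1 [r1 [st1]]]]] := touch_seq e_sym e_irr r0 s st (enum_uniq K).
- by move=> k; rewrite mem_enum; apply: (subsetP KW).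
- by move=> k l; rewrite !mem_enum; apply: ind.
have -> : [set k in enum K] = K by apply/setP => k; rewrite inE mem_enum.
move=> tc; have gr1 : graded D1 X1 hub1 r1 u1.
  by apply: touched_graded st gr tc u1_gt1 _ _; rewrite ltW // (lt_trans _ u1s) // ltrDl.
have [|r [c1 [fs pl]]] := IH st1 gr1.
  rewrite (touched_rest tc) cardsD (setIidPr KW) ltn_subrL !card_gt0 K0 /=.
  by apply: contraNneq K0 => W0; rewrite -subset0 -W0.
pose c := extended_partner D K D1 hub hub1 r1 r c1.
exists (D1 :|: X1), c, r, u1, delta; split.
- exact: touched_rest tc.
- exact: (extended_calibrated st gr st1 tc u1_gt1 delta0 u1s su pl).
- by move=> k kK; apply: (extended_placed e_sym st gr KW st1 tc pl).
- by move=> k kK kD; apply: extended_partner_follower.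
- move=> k kK kX; rewrite inE.
  by have [->] := extended_partner_alive st tc pl kK kX.
- move=> w wW1 cW1; have [wD1 cE] := extended_hub tc pl wW1 cW1.
  rewrite -/c in cE; case: (touched_cases tc wD1) => [[wD hE _]|[_ hK _]].
    by rewrite wD cE hE eqxx.
  by rewrite cE hK orbT.
- move=> gs bl gs_size; exists r, c, (gs ++ fs).
  exact: (placement_extend e_sym st gr KW st1 tc u1_gt1 delta0 u1s su pl bl).
Qed.

Definition siblings x y := [&& x \in D, y \in D & hub x == hub y].
(** Such an x cannot be the vertex a of [triple_block]: its sibling has the same
    partner as x and would be kept away from x. *)
Definition paired x := [exists y, [&& siblings x y, y != x & ~~ e x y]].

Lemma paired_sibling x y : siblings x y -> y != x -> ~~ e x y -> paired x.
Proof. by move=> *; apply/existsP; exists y; apply/and3P. Qed.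

Lemma siblings_sym x y : siblings x y = siblings y x.
Proof. by rewrite /siblings andbCA [hub x == _]eq_sym. Qed.

Lemma siblings_fibre x y z : siblings x y -> siblings x z -> [|| x == y, x == z | y == z].
Proof.
move=> /and3P[xD yD /eqP xy] /and3P[_ zD /eqP xz].
exact: (state_fibre st xD yD zD xy xz).
Qed.

Let partner_neq K W1 c r rho delta k l : step K W1 c r rho delta -> K \subset W ->
  k \in K -> l \in K -> ~~ siblings k l -> c k \notin W1 -> c k != c l.
Proof.
move=> sp KW kK lK nsib ckW.
have kD : k \in D.
  by have /WP/orP[//|kX] := subsetP KW k kK; rewrite (step_alive sp kK kX) in ckW.
have /WP/orP[lD|lX] := subsetP KW l lK; last first.
  by apply: contraNneq ckW => ->; apply: (step_alive sp).
apply: contra nsib => /eqP; rewrite (step_hub sp kK kD) (step_hub sp lK lD) /siblings kD lD.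
by move=> ->; rewrite eqxx.
Qed.

Lemma triple_step a b d : [&& a \in W, b \in W & d \in W] ->
  [&& ~~ e a b, ~~ e a d & ~~ e b d] -> [&& a != b, a != d & b != d] ->
  ~~ paired a -> ~~ siblings b d -> placeable D X hub r0 u.
Proof.
case/and3P=> aW bW dW /and3P[nab nad nbd] /and3P[ab ad bd] npa nsbd.
pose K := [set a; b; d].
have KP k : k \in K -> [\/ k = a, k = b | k = d].
  by rewrite /K !inE -orbA => /or3P[] /eqP->; [constructor 1|constructor 2|constructor 3].
have [aK bK dK] : [/\ a \in K, b \in K & d \in K] by rewrite /K !inE !eqxx !orbT.
have KW : K \subset W by apply/subsetP => k /KP[] ->.
have [nba nda ndb] : [/\ ~~ e b a, ~~ e d a & ~~ e d b].
  by rewrite [e b a]e_sym [e d a]e_sym [e d b]e_sym.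
have [||W1 [c [r [rho [delta sp]]]]] := step_exists (K := K) _ KW.
- by apply/set0Pn; exists a.
- by move=> k l /KP[] -> /KP[] ->; rewrite ?e_irr.
have nsab x : ~~ e a x -> x != a -> ~~ siblings a x.
  by move=> nax xa; apply: contra npa => sax; apply: paired_sibling sax xa nax.
have pneq x y : x \in K -> y \in K -> ~~ siblings x y -> c x \notin W1 -> c x != c y.
  exact: (partner_neq sp KW).
have KW1 k : k \in K -> k \notin W1 by rewrite (step_rest sp) in_setD => ->.
have [||||gs [gs2 bl]] := triple_block e_sym e_irr (step_calibrated sp)
   (step_placed sp aK) (step_placed sp bK) (step_placed sp dK) nab nad nbd ab ad bd.
- by apply: pneq; rewrite // siblings_sym nsab // eq_sym.
- by apply: pneq; rewrite // siblings_sym nsab // eq_sym.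
- by apply: pneq; rewrite // siblings_sym.
- move=> w wW1 caW1 cwa; have cwW1 : c w \notin W1 by rewrite cwa.
  have aD : a \in D.
    by have /WP/orP[//|aX] := aW; rewrite (step_alive sp aK aX) in caW1.
  have := step_cases sp wW1 cwW1; rewrite cwa (step_hub sp aK aD).
  case/orP=> [/andP[wD hE]|]; last by move=> /setIP[/(subsetP KW)]; rewrite (negPf (hub_out aD)).
  apply: contraNT npa => naw; apply: (paired_sibling (y := w)) => //.
    by rewrite /siblings aD wD.
  by apply: contraTneq wW1 => ->; apply: KW1.
apply: (step_extend sp bl); rewrite gs2.
suff -> : #|K| = 3 by [].
by rewrite /K setUC cardsU1 cards2 ab !inE negb_or eq_sym ad eq_sym bd.
Qed.

Lemma pair_step a b : a \in W -> b \in W -> ~~ e a b -> a != b -> ~~ siblings a b ->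
  {in W, forall w, w != a -> w != b -> e a w || e b w} -> placeable D X hub r0 u.
Proof.
move=> aW bW nab ab nsib dom; pose K := [set a; b].
have KP k : k \in K -> k = a \/ k = b by rewrite /K !inE => /orP[] /eqP->; [left|right].
have [aK bK] : a \in K /\ b \in K by rewrite /K !inE !eqxx orbT.
have KW : K \subset W by apply/subsetP => k /KP[] ->.
have [||W1 [c [r [rho [delta sp]]]]] := step_exists (K := K) _ KW.
- by apply/set0Pn; exists a.
- by move=> k l /KP[] -> /KP[] ->; rewrite ?e_irr // e_sym.
have [||gs [gs1 bl]] := pair_block e_sym e_irr (step_calibrated sp)
   (step_placed sp aK) (step_placed sp bK) nab ab.
- exact: (partner_neq sp KW).
- move=> w; rewrite (step_rest sp) !inE negb_or => /andP[/andP[wa wb] wW].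
  by apply: dom; rewrite // inE.
by apply: (step_extend sp bl); rewrite gs1 /K cards2 ab.
Qed.

Lemma sibling_step a l m : a \in W -> siblings l m ->
  [&& ~~ e a l, ~~ e a m & ~~ e l m] -> [&& a != l, a != m & l != m] ->
  {in W, forall w, w \notin [set a; l; m] -> [|| e a w, e l w | e m w]} ->
  placeable D X hub r0 u.
Proof.
move=> aW sib /and3P[nal nam nlm] /and3P[al am lm] dom.
have /and3P[lD mD /eqP hlm] := sib.
pose K := [set a; l; m].
have [lW mW] : l \in W /\ m \in W by rewrite !inE lD mD.
have KP k : k \in K -> [\/ k = a, k = l | k = m].
  by rewrite /K !inE -orbA => /or3P[] /eqP->; [constructor 1|constructor 2|constructor 3].
have [aK lK mK] : [/\ a \in K, l \in K & m \in K] by rewrite /K !inE !eqxx !orbT.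
have KW : K \subset W by apply/subsetP => k /KP[] ->.
have [nla nma nml] : [/\ ~~ e l a, ~~ e m a & ~~ e m l].
  by rewrite [e l a]e_sym [e m a]e_sym [e m l]e_sym.
have [||W1 [c [r [rho [delta sp]]]]] := step_exists (K := K) _ KW.
- by apply/set0Pn; exists a.
- by move=> k k' /KP[] -> /KP[] ->; rewrite ?e_irr.
have [cl cm] : c l = hub l /\ c m = hub m by rewrite !(step_hub sp).
have clW1 : c l \notin W1.
  by rewrite cl (step_rest sp) inE negb_and (hub_out lD) orbT.
have no_partner x w : x \in D -> x \in K -> w \in W1 -> c w != x.
  move=> xD xK wW1; apply/eqP => cw.
  have xW1 : c w \notin W1 by rewrite cw (step_rest sp) inE xK.
  have := step_cases sp wW1 xW1; rewrite cw inE (disjointFr DX xD) andbF orbF.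
  by case/andP=> wD /eqP xh; have := hub_out wD; rewrite -xh inE xD.
have [||||gs [gs2 bl]] := sibling_block e_sym e_irr (step_calibrated sp)
   (step_placed sp aK) (step_placed sp lK) (step_placed sp mK) nal nam nlm al am lm clW1.
- by rewrite cl cm hlm.
- rewrite eq_sym; apply: (partner_neq sp KW) => //; apply/negP => sla.
  by have := siblings_fibre sib sla; rewrite (negPf lm) eq_sym (negPf al) eq_sym (negPf am).
- by move=> w wW1; rewrite !no_partner.
- by move=> w; rewrite (step_rest sp) inE => /andP[wK wW]; apply: dom.
apply: (step_extend sp bl); rewrite gs2.
suff -> : #|K| = 3 by [].
by rewrite /K setUC cardsU1 cards2 al !inE negb_or eq_sym am eq_sym lm.
Qed.

End Step.
End Steps.

(** * The process always ends in a placement *)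

Section Termination.
Variables (R : realFieldType) (T : finType) (e : rel T).
Hypotheses (e_sym : symmetric e) (e_irr : irreflexive e).
Implicit Types (D X K L : {set T}) (hub c : T -> T) (r : T -> R) (u : R).

(** Two adjacent followers l and k return to the cover as an edge. Their hubs
    keep the followers l' and k'. *)
Lemma rematch_step D X hub (r0 : T -> R) u l k l' k' :
  state e D X hub -> graded D X hub r0 u ->
  (forall D1 X1, D1 :|: X1 = D :|: X -> (#|D1| < #|D|)%N -> state e D1 X1 hub ->
    graded D1 X1 hub r0 u -> placeable e D1 X1 hub r0 u) ->
  siblings D hub l l' -> l' != l -> siblings D hub k k' -> k' != k ->
  hub l != hub k -> e l k -> placeable e D X hub r0 u.
Proof.
move=> st gr IH /and3P[lD l'D /eqP hl] ll /and3P[kD k'D /eqP hk] kk hlk elk.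
have DX := state_disjoint st.
pose D1 := D :\: [set l; k]; pose X1 := l |: (k |: X).
have WE : D1 :|: X1 = D :|: X.
  apply/setP => v; rewrite !inE; case: (eqVneq v l) => [->|vl]; first by rewrite lD.
  by case: (eqVneq v k) => [->|vk] //=; rewrite kD.
have D1D : D1 \subset D by apply: subsetDl.
have inD1 v : v \in D -> v != l -> v != k -> v \in D1.
  by move=> vD vl vk; rewrite !inE negb_or vl vk.
have st1 : state e D1 X1 hub.
  split.
  - rewrite disjoints_subset; apply/subsetP => v; rewrite !inE !negb_or => /andP[/andP[-> ->] vD].
    by rewrite (disjointFr DX vD).
  - apply: two_matchable_edge => //; first exact: state_matchable st.
      by rewrite (disjointFr DX lD).
    by rewrite (disjointFr DX kD).
  - by move=> w /(subsetP D1D) wD; rewrite WE (state_hub_out st).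
  - by move=> w /(subsetP D1D) wD; rewrite (state_hub_adj st).
  - move=> w1 w2 w3 /(subsetP D1D) w1D /(subsetP D1D) w2D /(subsetP D1D) w3D.
    exact: (state_fibre st w1D w2D w3D).
have X1X v : v \notin X1 -> v \notin X by rewrite !inE !negb_or => /and3P[].
have gr1 : graded D1 X1 hub r0 u.
  split.
  - exact: graded_gt1 gr.
  - by move=> v /X1X /(graded_ge gr).
  - by move=> v /X1X /(graded_le gr).
  - exact: graded_u gr.
  - by move=> w /(subsetP D1D) /(graded_hub gr).
have [|r [c [fs pl]]] := IH D1 X1 WE _ st1 gr1.
  apply: proper_card; rewrite properE D1D; apply/subsetPn; exists l => //.
  by rewrite !inE eqxx.
have alive v : v \in X1 -> 1 <= r v < u := placement_alive pl (x := v).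
exists r, c, fs; split.
- by move=> v vX; apply: alive; rewrite !inE vX !orbT.
- by move=> v vW; rewrite (placement_out pl) ?WE.
- move=> v vD; have [vl|vl] := eqVneq v l; first by right; apply: alive; rewrite !inE vl eqxx.
  have [vk|vk] := eqVneq v k; first by right; apply: alive; rewrite !inE vk eqxx orbT.
  exact: (placement_follower pl (inD1 v vD vl vk)).
- by rewrite -WE; apply: (placement_adj pl).
- by rewrite -WE; apply: (placement_partner pl).
- by rewrite -WE; apply: (placement_low pl).
- move=> w wD; have [w1 w1D hw] : exists2 w1, w1 \in D1 & hub w1 = hub w.
    have [->|wl] := eqVneq w l.
      exists l' => //; apply: inD1 => //.
      by apply: contraNneq hlk => <-; rewrite hl.
    have [->|wk] := eqVneq w k.
      exists k' => //; apply: inD1 => //.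
      by apply: contraNneq hlk => <-; rewrite hk.
    by exists w; rewrite ?inD1.
  have [w' [w'D1 h' r' c']] := placement_hub pl w1D.
  by exists w'; split; rewrite ?c' ?r' ?h' ?hw //; apply: (subsetP D1D).
- exact: (placement_compatible pl).
- by rewrite -WE; apply: (placement_short pl).
- by rewrite -WE; apply: (placement_short_out pl).
- by rewrite -WE; apply: (placement_covers pl).
- by rewrite -WE; apply: (placement_separates pl).
- rewrite -WE => p w pW wW epw urw hp; apply: (placement_separates_out pl) => //.
  by move=> w' /(subsetP D1D); apply: hp.
- by rewrite -WE; apply: (placement_size pl).
Qed.

(** Suppose that no step applies. Let v be a vertex without a non-adjacent
    sibling and w a non-neighbour of v. By [pair_step] they have a common
    non-neighbour x, by [triple_step] w and x are siblings, and by
    [sibling_step] there is a fourth vertex y not adjacent to v, w and x; but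
    then also y is a sibling of w, and a hub has at most two followers. So every
    vertex outside the set L of the paired vertices is adjacent to all others.
    The members of L come in pairs of non-adjacent siblings, and adjacent ones
    from different pairs are excluded by [rematch_step]. The induction is on the
    number of vertices left, then on the number of followers. *)
Theorem process D X hub (r0 : T -> R) u :
  state e D X hub -> graded D X hub r0 u -> placeable e D X hub r0 u.
Proof.
have [n] := ubnP (#|D :|: X| * #|T|.+1 + #|D|)%N.
elim: n D X hub r0 u => // n IHn D X hub r0 u /ltnSE-size_n st gr.
set W := D :|: X in size_n *.
have IH D1 X1 hub1 (r1 : T -> R) u1 : state e D1 X1 hub1 -> graded D1 X1 hub1 r1 u1 ->
    (#|D1 :|: X1| < #|W|)%N -> placeable e D1 X1 hub1 r1 u1.
  move=> st1 gr1 lt1; apply: IHn st1 gr1; apply: leq_trans size_n.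
  have D1T := max_card (mem D1).
  apply: (@leq_trans (#|D1 :|: X1|.+1 * #|T|.+1)); last by rewrite (leq_trans _ (leq_addr _ _)) // leq_mul2r lt1 orbT.
  by rewrite mulSn addnC ltn_add2r ltnS.
have IH' D1 X1 : D1 :|: X1 = W -> (#|D1| < #|D|)%N -> state e D1 X1 hub ->
    graded D1 X1 hub r0 u -> placeable e D1 X1 hub r0 u.
  move=> WE lt1 st1 gr1; apply: IHn st1 gr1; apply: leq_trans size_n.
  by rewrite WE ltn_add2l.
apply: contrapT => stuck.
pose sib := siblings D hub; pose pr := paired e D hub.
have sib_nonadj x y : ~~ pr x -> x != y -> ~~ e x y -> ~~ sib x y.
  move=> nx xy nxy; apply: contra nx => sxy.
  by apply: paired_sibling sxy _ nxy; rewrite eq_sym.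
have no_triple a b d : a \in W -> b \in W -> d \in W -> ~~ e a b -> ~~ e a d -> ~~ e b d ->
    a != b -> a != d -> b != d -> ~~ pr a -> sib b d.
  move=> aW bW dW nab nad nbd ab ad bd npa; apply/negPn/negP => nsbd; apply: stuck.
  apply: (triple_step e_sym e_irr st gr IH (a := a) (b := b) (d := d)) => //.
  - by rewrite aW bW.
  - by rewrite nab nad.
  - by rewrite ab ad.
have F_adj : {in W :\: [set w | pr w], forall v w, w \in W -> v != w -> e v w}.
  move=> v; rewrite in_setD inE => /andP[npv vW] w wW vw; apply/negPn/negP => nvw.
  have nsvw := sib_nonadj v w npv vw nvw.
  have [x [xW xv xw] [nvx nwx]] : exists2 x, [/\ x \in W, x != v & x != w] & ~~ e v x /\ ~~ e w x.
    apply: contrapT => nox; apply: stuck.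
    apply: (pair_step e_sym e_irr st gr IH vW wW) => // x xW xv xw.
    apply/negPn/negP => /norP[nvx nwx]; by apply: nox; exists x.
  have swx : sib w x by apply: (no_triple v w x); rewrite // eq_sym.
  apply: stuck; apply: (sibling_step e_sym e_irr st gr IH vW swx).
  - by rewrite nvw nvx.
  - by rewrite vw eq_sym xv eq_sym xw.
  move=> y yW; rewrite !inE !negb_or -andbA => /and3P[yv yw yx].
  apply/negPn/negP => /norP[nvy /norP[nwy nxy]].
  have swy : sib w y by apply: (no_triple v w y); rewrite // eq_sym.
  have := siblings_fibre st swx swy.
  by rewrite eq_sym (negPf xw) eq_sym (negPf yw) eq_sym (negPf yx).
pose L := [set w | pr w].
have LP w : w \in L -> exists y, [/\ sib w y, y != w, ~~ e w y & y \in L].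
  rewrite inE => /existsP[y /and3P[swy yw nwy]]; exists y; split=> //.
  by rewrite inE; apply: (paired_sibling (y := w)); rewrite 1?siblings_sym 1?eq_sym 1?e_sym.
have LD : L \subset D by apply/subsetP => w /LP[y [/and3P[]]].
apply: (stuck); apply: (stuck_placement e_sym e_irr st gr LD) => //.
- move=> l k lL kL; apply/negP => elk.
  have [[l' [sl ll nll _]] [k' [sk kk _ _]]] := conj (LP l lL) (LP k kL).
  have [hlk|hlk] := eqVneq (hub l) (hub k); last first.
    apply: (stuck); exact: (rematch_step st gr IH' sl ll sk kk hlk elk).
  have slk : sib l k by rewrite /sib /siblings (subsetP LD) // (subsetP LD) // hlk eqxx.
  have /or3P[/eqP lk|/eqP l'l|/eqP l'k] := siblings_fibre st slk sl.
  + by rewrite lk e_irr in elk.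
  + by rewrite l'l eqxx in ll.
  + by rewrite -l'k elk in nll.
- apply/negP => /cards1P[l LE]; have [|y [_ yl _]] := LP l; first by rewrite LE inE.
  by rewrite LE inE (negPf yl).
- apply/negP => /eqP L3; have /set0Pn[l lL] : L != set0 by rewrite -card_gt0 L3.
  have [y [sly yl _ yL]] := LP l lL.
  have : #|L :\ l :\ y| == 1%N.
    have := cardsD1 l L; have := cardsD1 y (L :\ l).
    by rewrite lL L3 in_setD1 yl yL /= !add1n => -> [<-].
  case/cards1P=> z zE; have : z \in L :\ l :\ y by rewrite zE inE.
  rewrite !in_setD1 => /and3P[zy zl zL]; have [z' [szz' z'z _ z'L]] := LP z zL.
  have : z' \notin L :\ l :\ y by rewrite zE inE.
  rewrite !in_setD1 z'L andbT negb_and !negbK => /orP[] /eqP z'E.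
    have := siblings_fibre st (x := y) (y := l) (z := z).
    rewrite siblings_sym -/(sib l y) sly siblings_sym -z'E -/(sib z z') szz'.
    by rewrite z'E (negPf yl) eq_sym (negPf zy) eq_sym (negPf zl) => /(_ isT isT).
  have := siblings_fibre st sly (z := z); rewrite siblings_sym -z'E -/(sib z z') szz'.
  by rewrite z'E eq_sym (negPf yl) eq_sym (negPf zl) eq_sym (negPf zy) => /(_ isT).
Qed.
End Termination.

(** * The vertices outside the matching *)

Section Representation.
Variables (R : realFieldType) (T : finType) (e : rel T).
Hypotheses (e_sym : symmetric e) (e_irr : irreflexive e).

(** The condition [representation_short] makes r v the distance from v to its
    nearest point, provided that no point is closer. *)
Record representation (r : T -> R) (fs : seq (T -> R)) : Prop := Representation {
  representation_ge1 : forall v, 1 <= r v;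
  representation_compatible : forall f, f \in fs -> compatible e r f;
  representation_short : forall v, exists2 w, e v w & r w = r v /\
    forall f, f \in fs -> `|f v - f w| <= r v;
  representation_covers : forall v w, v != w -> ~~ e v w ->
    exists2 f, f \in fs & covers r f v w;
  representation_separates : forall v w, e v w -> exists2 f, f \in fs & separates r f v w }.

Section Deficient.
Variables (A S : {set T}) (r : T -> R).
Hypotheses (AS : [disjoint A & S]) (S_A : {in S, forall s v, e s v -> v \in A}).
Hypotheses (r1 : forall v, 1 <= r v) (r54 : forall v, r v <= 5 / 4).
Hypothesis rAS : {in A :|: S, forall v, r v = 5 / 4}.

Let rA v : v \in A -> r v = 5 / 4. Proof. by move=> vA; rewrite rAS // inE vA. Qed.
Let rS v : v \in S -> r v = 5 / 4. Proof. by move=> vS; rewrite rAS // inE vS orbT. Qed.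

(** The coordinate of a vertex a of A: the ball of a ends at 0, non-neighbours of
    a touch it, and neighbours overlap it. The neighbours in S, which may have a
    as partner, are at distance r a. *)
Definition vertex_map a v : R :=
  if v == a then - (5 / 4) else if e a v then (if v \in S then 0 else 1 / 2) else r v.

(** The members of S are at the ends according to the i-th digit of their code,
    with their neighbours in the middle. The vertices of the rest touch the
    balls of those with digit zero, and no code consists of ones only. *)
Definition code_map i v : R :=
  if v \in S then (if bit (index v (enum S)) i then 5 / 4 else - (5 / 4))
  else if v \in A then 0 else r v.

Let vertex_map_ge v a : v != a -> v \notin S -> 1 / 2 <= vertex_map a v <= 5 / 4.
Proof.
move=> va vS; rewrite /vertex_map (negPf va) (negPf vS).
have := r1 v; have := r54 v; case: ifP => _ *; apply/andP; split; lra.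
Qed.

Let vertex_map_ge0 v a : v != a -> 0 <= vertex_map a v <= 5 / 4.
Proof.
move=> va; have [vS|vS] := boolP (v \in S); last first.
  by have /andP[? ?] := vertex_map_ge va vS; apply/andP; split; lra.
rewrite /vertex_map (negPf va) vS.
have := r1 v; have := r54 v; case: ifP => _ *; apply/andP; split; lra.
Qed.

Let vertex_map_self a : vertex_map a a = - (5 / 4).
Proof. by rewrite /vertex_map eqxx. Qed.

Let neq_adj v w : e v w -> v != w.
Proof. by apply: contraTneq => ->; rewrite e_irr. Qed.

Let vertex_compatible_self a v : a \in A -> e a v -> `|vertex_map a a - vertex_map a v| < r a + r v.
Proof.
move=> aA av; have va := neq_adj av; rewrite vertex_map_self (rA aA) /vertex_map eq_sym (negPf va) av.
have ? := r1 v; have [vS|vS] := boolP (v \in S); rewrite ltr_norml; apply/andP; split; lra.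
Qed.

Lemma vertex_map_compatible a : a \in A -> compatible e r (vertex_map a).
Proof.
move=> aA v w vw; have [va|va] := eqVneq v a.
  by rewrite va; apply: vertex_compatible_self; rewrite // -va.
have [wa|wa] := eqVneq w a.
  by rewrite wa distrC [r v + _]addrC; apply: vertex_compatible_self; rewrite // -wa e_sym.
have /andP[? ?] := vertex_map_ge0 va; have /andP[? ?] := vertex_map_ge0 wa.
have ? := r1 v; have ? := r1 w; rewrite ltr_norml; apply/andP; split; lra.
Qed.

Lemma vertex_map_short_rest a v w : a \in A -> v \notin A :|: S -> w \notin A :|: S ->
  `|vertex_map a v - vertex_map a w| <= r v.
Proof.
rewrite !in_setU !negb_or => aA /andP[vA vS] /andP[wA wS].
have va : v != a by apply: contraNneq vA => ->.
have wa : w != a by apply: contraNneq wA => ->.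
have /andP[? ?] := vertex_map_ge va vS; have /andP[? ?] := vertex_map_ge wa wS.
have ? := r1 v; rewrite ler_norml; apply/andP; split; lra.
Qed.

Lemma vertex_map_short a b s : a \in A -> b \in A -> s \in S -> e b s ->
  `|vertex_map a b - vertex_map a s| <= 5 / 4.
Proof.
move=> aA bA sS bs; have sa : s != a by apply: contraTneq sS => ->; rewrite (disjointFr AS aA).
have [ba|ba] := eqVneq b a.
  rewrite -ba vertex_map_self /vertex_map sS bs eq_sym (negPf (neq_adj bs)).
  by rewrite ler_norml; apply/andP; split; lra.
have /andP[? ?] := vertex_map_ge0 ba; have /andP[? ?] := vertex_map_ge0 sa.
rewrite ler_norml; apply/andP; split; lra.
Qed.

Lemma vertex_map_covers a v : a \in A -> v != a -> ~~ e a v -> covers r (vertex_map a) a v.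
Proof.
move=> aA va /negPf nav; apply: coversl.
by rewrite vertex_map_self /vertex_map (negPf va) nav (rA aA) opprK addrC.
Qed.

Lemma vertex_map_separates a v : a \in A -> e a v -> separates r (vertex_map a) a v.
Proof.
move=> aA av; have := neq_adj av; rewrite eq_sym => /negPf va.
have ? := r54 v; have ? := rA aA.
by apply: separatesl; rewrite vertex_map_self /vertex_map va av; case: ifP => _; lra.
Qed.

Lemma code_map_compatible i : compatible e r (code_map i).
Proof.
move=> v w; wlog: v w / (w \in S) ==> (v \in S) => [wl vw|].
  have [/wl/(_ vw)//|] := boolP ((w \in S) ==> (v \in S)).
  rewrite negb_imply => /andP[wS vS]; rewrite distrC [r v + _]addrC.
  by apply: wl; [rewrite wS implybT | rewrite e_sym].
move=> wv vw; have [? [? [? ?]]] := (r1 v, (r1 w, (r54 v, r54 w))).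
have [vS|vS] := boolP (v \in S); last first.
  rewrite (negPf vS) implybF in wv; rewrite /code_map (negPf vS) (negPf wv).
  by do 2 case: ifP => _; rewrite ltr_norml; apply/andP; split; lra.
have wA := S_A vS vw; rewrite /code_map vS (disjointFr AS wA) wA.
have ? := rS vS; have ? := rA wA.
by case: ifP => _; rewrite ltr_norml; apply/andP; split; lra.
Qed.

Lemma code_map_short_rest i v w : v \notin A :|: S -> w \notin A :|: S -> r w = r v ->
  `|code_map i v - code_map i w| <= r v.
Proof.
rewrite !in_setU !negb_or => /andP[vA vS] /andP[wA wS] rw.
rewrite /code_map (negPf vS) (negPf vA) (negPf wS) (negPf wA) rw subrr normr0.
by have ? := r1 v; lra.
Qed.

Lemma code_map_short i b s : b \in A -> s \in S -> `|code_map i b - code_map i s| <= 5 / 4.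
Proof.
move=> bA sS; rewrite /code_map (disjointFr AS bA) bA sS.
by case: ifP => _; rewrite ler_norml; apply/andP; split; lra.
Qed.

Lemma code_map_covers_rest i s v : s \in S -> v \notin A :|: S ->
  ~~ bit (index s (enum S)) i -> covers r (code_map i) s v.
Proof.
rewrite in_setU negb_or => sS /andP[vA vS] /negPf zero.
by apply: coversl; rewrite /code_map sS (negPf vS) (negPf vA) zero (rS sS); lra.
Qed.

Lemma code_map_covers i s t : s \in S -> t \in S ->
  bit (index s (enum S)) i != bit (index t (enum S)) i -> covers r (code_map i) s t.
Proof.
move=> sS tS; have ? := rS sS; have ? := rS tS.
case bs : (bit _ i); case bt : (bit _ i) => // _.
  by apply: coversr; rewrite /code_map sS tS bs bt; lra.
by apply: coversl; rewrite /code_map sS tS bs bt; lra.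
Qed.
End Deficient.

(** The rest starts as a state without followers. The maps for A and S number
    #|A| + up_log 2 #|S|.+1. *)
Lemma small_representation : (forall v, exists w, e v w) ->
  exists r fs, representation r fs /\ (3 * size fs <= 2 * #|T| + 6)%N.
Proof.
move=> nonisolated.
have [A [S [AS S_A A_S cardAS]]] := deficiency_decomposition e_sym.
set X := ~: (A :|: S) => X_matchable.
have XE v : (v \in X) = (v \notin A :|: S) by rewrite inE.
have [||r [c [fs0 pl]]] := @process R T e e_sym e_irr set0 X id (fun=> 5 / 4) (5 / 4).
- by split=> //; [rewrite -setI_eq0 set0I | move=> w; rewrite inE | move=> w; rewrite inE
    | move=> w1 w2 w3; rewrite inE].
- by split=> //; lra.
have rX v : v \in X -> 1 <= r v < 5 / 4 by apply: placement_alive pl v.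
have rAS : {in A :|: S, forall v, r v = 5 / 4}.
  by move=> v vAS; rewrite (placement_out pl) // set0U XE negbK.
have r1 v : 1 <= r v.
  by have [/rAS->|] := boolP (v \in A :|: S); [lra | rewrite -XE => /rX/andP[]].
have r54 v : r v <= 5 / 4.
  by have [/rAS->|] := boolP (v \in A :|: S); rewrite // -XE => /rX/andP[_ /ltW].
pose B := up_log 2 #|S|.+1.
pose fs := [seq vertex_map S r a | a <- enum A] ++ mkseq (code_map A S r) B ++ fs0.
have fsP (P : (T -> R) -> Prop) : {in A, forall a, P (vertex_map S r a)} ->
    (forall i, P (code_map A S r i)) -> (forall f, f \in fs0 -> P f) ->
    forall f, f \in fs -> P f.
  move=> PA PS P0 f; rewrite !mem_cat => /or3P[/mapP[a + ->]|/mapP[i _ ->]|/P0//].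
    by rewrite mem_enum => /PA.
  exact: PS.
have in_vertex a : a \in A -> vertex_map S r a \in fs.
  by move=> aA; rewrite mem_cat map_f ?mem_enum.
have in_code i : (i < B)%N -> code_map A S r i \in fs.
  by move=> iB; rewrite !mem_cat map_f ?mem_iota ?orbT.
have in_rest f : f \in fs0 -> f \in fs by rewrite !mem_cat => ->; rewrite !orbT.
have SB : (#|S| < 2 ^ B)%N by apply: up_logP.
have short_AS a s f : a \in A -> s \in S -> e a s -> f \in fs -> `|f a - f s| <= 5 / 4.
  move=> aA sS as_ fF; have [ra rs] : r a = 5 / 4 /\ r s = 5 / 4.
    by rewrite !rAS // in_setU ?aA ?sS ?orbT.
  move: f fF; apply: fsP => [b bA|i|f f0].
  - exact: (vertex_map_short AS r1 r54).
  - exact: code_map_short.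
  - by rewrite -ra; apply: (placement_short_out pl f0); rewrite set0U XE negbK in_setU ?aA ?sS ?orbT.
exists r, fs; split; first split=> //.
- apply: fsP => [a aA|i|f f0].
  + exact: (vertex_map_compatible r1 r54 rAS).
  + exact: (code_map_compatible AS S_A r1 r54 rAS).
  + exact: (placement_compatible pl f0).
- move=> v; have [|vX] := boolP (v \in A :|: S); last first.
    have vX' : v \in set0 :|: X by rewrite set0U XE.
    have cX : c v \in X.
      have := placement_low pl vX'; rewrite set0U; apply.
      by have := rX v; rewrite XE vX => /(_ isT)/andP[].
    exists (c v); first exact: (placement_adj pl).
    split; first exact: (placement_partner pl).
    apply: fsP => [a aA|i|f f0].
    + by apply: (vertex_map_short_rest r1 r54 aA vX); rewrite -XE.
    + by apply: code_map_short_rest => //; [rewrite -XE | exact: (placement_partner pl)].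
    + exact: (placement_short pl).
  rewrite in_setU => /orP[vA|vS].
    have [s sS sv] := A_S v vA; exists s; first by rewrite e_sym.
    rewrite !rAS ?in_setU ?vA ?sS ?orbT //; split=> // f fF.
    by apply: short_AS; rewrite // e_sym.
  have [w vw] := nonisolated v; have wA := S_A v vS w vw; exists w => //.
  rewrite !rAS ?in_setU ?wA ?vS ?orbT //; split=> // f fF.
  by rewrite distrC; apply: short_AS; rewrite // e_sym.
- have half v w : (v \in A) || (w \notin A) && ((v \in S) || (w \notin S)) ->
      v != w -> ~~ e v w -> exists2 f, f \in fs & covers r f v w.
    move=> cases vw nvw; have [vA|vA] := boolP (v \in A).
      by exists (vertex_map S r v); [apply: in_vertex | apply: (vertex_map_covers rAS); rewrite 1?eq_sym].
    move: cases; rewrite (negPf vA) /= => /andP[wA cases].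
    have idx x : x \in S -> (index x (enum S) < 2 ^ B)%N.
      by move=> xS; apply: leq_trans (index_enum_lt xS) (ltnW SB).
    have [vS|vS] := boolP (v \in S); have [wS|wS] := boolP (w \in S).
    + have [|||i iB ib] := @bit_neq B (index v (enum S)) (index w (enum S)); try exact: idx.
        by apply: contra_neq vw; apply: index_enum_inj.
      by exists (code_map A S r i); [apply: in_code | apply: (code_map_covers rAS)].
    + have [|i iB ib] := @bit_zero B (index v (enum S)).
        by apply: leq_ltn_trans SB; apply: index_enum_lt.
      exists (code_map A S r i); first exact: in_code.
      by apply: (code_map_covers_rest rAS); rewrite // in_setU negb_or wA.
    + by rewrite (negPf vS) wS in cases.
    + have [f f0 cf] : exists2 f, f \in fs0 & covers r f v w.
        by apply: (placement_covers pl); rewrite // set0U XE in_setU negb_or ?vA ?wA.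
      by exists f; first exact: in_rest.
  move=> v w vw nvw.
  have [cases|ncases] := boolP ((v \in A) || (w \notin A) && ((v \in S) || (w \notin S))).
    exact: half.
  have [|||f fF cf] := half w v; rewrite 1?eq_sym 1?e_sym //.
    by move: ncases; do 4 case: (_ \in _).
  by exists f; rewrite // coversC.
- have half v w : e v w -> (v \in A) || (v \in X) && (w \in X) ->
      exists2 f, f \in fs & separates r f v w.
    move=> vw /orP[vA|/andP[vX wX]].
      by exists (vertex_map S r v); [apply: in_vertex | apply: (vertex_map_separates r54 rAS)].
    have [f f0 cf] : exists2 f, f \in fs0 & separates r f v w.
      by apply: (placement_separates pl); rewrite // set0U.
    by exists f; first exact: in_rest.
  move=> v w vw; have [/(half v w vw) //|nv] := boolP ((v \in A) || (v \in X) && (w \in X)).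
  have hv : v \in S -> w \in A by move=> vS; exact: (S_A v vS w vw).
  have hw : w \in S -> v \in A by move=> wS; apply: (S_A w wS); rewrite e_sym.
  have [||f fF cf] := half w v; first by rewrite e_sym.
    by move: nv hv hw; rewrite !XE !in_setU; case: (v \in A); case: (w \in A); case: (v \in S); case: (w \in S) => //= _ hv hw; (by have := hv isT) || (by have := hw isT).
  by exists f; rewrite // separatesC.
have size0 := placement_size pl; rewrite set0U in size0.
rewrite !size_cat size_map size_mkseq -cardE.
have sizeT : (#|A| + #|S| + #|X| = #|T|)%N.
  by rewrite -(cardsC (A :|: S)) -/X cardsU (disjoint_setI0 AS) cards0 subn0.
suff : (3 * (#|A| + B) <= 2 * (#|A| + #|S|) + 4)%N by lia.
case/orP: cardAS => [/andP[/eqP A0 /eqP S0]|ltAS].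
  by rewrite /B A0 S0 cards0 up_log1.
have := up_log2_third #|S|.+1; rewrite -/B; lia.
Qed.
End Representation.

Import numFieldNormedType.Exports.

(** * From coordinates to sphere of influence graphs *)

Section Realization.
Variables (R : realType) (G : sgraph) (r : G -> R) (fs : seq (G -> R)).
Hypothesis rep : representation (@adj G) r fs.

Let d := size fs.
Definition point (v : G) : 'rV[R]_d := \row_i nth (fun=> 0) fs i v.

Let r_gt0 v : 0 < r v. Proof. exact: lt_le_trans ltr01 (representation_ge1 rep v). Qed.

Lemma rho_point_le u v b : 0 <= b -> (forall f, f \in fs -> `|f u - f v| <= b) ->
  rho (point u) (point v) <= b.
Proof.
by move=> b0 h; rewrite rhoE; apply/bigmax_leP; split=> // i _; rewrite !mxE h ?mem_nth.
Qed.

Lemma rho_point_lt u v b : 0 < b -> (forall f, f \in fs -> `|f u - f v| < b) ->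
  rho (point u) (point v) < b.
Proof.
by move=> b0 h; rewrite rhoE; apply/bigmax_ltP; split=> // i _; rewrite !mxE h ?mem_nth.
Qed.

Lemma rho_point_ge u v f : f \in fs -> `|f u - f v| <= rho (point u) (point v).
Proof.
move=> fF; rewrite rhoE; have i_lt : (index f fs < d)%N by rewrite index_mem.
apply: le_trans (@le_bigmax _ _ _ 0 (fun i => `|point u ord0 i - point v ord0 i|)
  (Ordinal i_lt)).
by rewrite !mxE /= nth_index.
Qed.

Lemma radius_le_rho u v : u != v -> r v <= rho (point u) (point v).
Proof.
move=> uv; have [auv|nauv] := boolP (adj u v).
  have [f fF /andP[_ fv]] := representation_separates rep auv.
  exact: le_trans fv (rho_point_ge u v fF).
have [f fF cov] := representation_covers rep uv nauv.
apply: le_trans (le_trans cov (rho_point_ge u v fF)).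
by rewrite lerDr ltW.
Qed.

Lemma point_inj : injective point.
Proof.
move=> u v uv; apply/eqP; apply: contraT => /radius_le_rho.
by rewrite uv /rho subrr normr0 leNgt r_gt0.
Qed.

Let P : {fset 'rV[R]_d} := [fset point x | x : G]%fset.

Let pointP x : point x \in P.
Proof. exact: in_imfset. Qed.

Lemma radius_point v : radius P (point v) = r v.
Proof.
apply: minimumP.
  have [w vw [rw short]] := representation_short rep v.
  have wv : w != v by apply: contraTneq vw => ->; rewrite adj_irrefl.
  exists (point w); first by rewrite /= pointP (inj_eq point_inj).
  apply/le_anti; rewrite radius_le_rho // andbT /rho distrC.
  by apply: rho_point_le short; apply: ltW.
move=> _ [p [/imfsetP[u _ ->] +] <-]; rewrite (inj_eq point_inj).
exact: radius_le_rho.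
Qed.

Lemma adj_rho u v : u != v -> adj u v = (rho (point u) (point v) < r u + r v).
Proof.
move=> uv; have [auv|nauv] := boolP (adj u v).
  symmetry; apply: rho_point_lt; first exact: addr_gt0.
  by move=> f fF; apply: (representation_compatible rep).
have [f fF cov] := representation_covers rep uv nauv.
by apply/esym/negbTE; rewrite -leNgt; apply: le_trans cov (rho_point_ge u v fF).
Qed.

(** One direction is the triangle inequality; for the other, the point that
    divides the segment between the centres in the ratio of the radii lies in
    both balls. *)
Lemma influence_meet u v : u != v ->
  (influence P (point u) `&` influence P (point v) !=set0)%classic <->
  rho (point u) (point v) < r u + r v.
Proof.
move=> uv; rewrite /influence !radius_point; set p := point u; set q := point v.
have [ru rv] := (r_gt0 u, r_gt0 v); split=> [[z [/= zu zv]]|lt_rho].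
  rewrite /rho (_ : p - q = (z - q) - (z - p)); last by rewrite opprB [RHS]addrC subrKA.
  by rewrite [ltRHS]addrC (le_lt_trans (ler_normB _ _)) ?ltrD.
set s := r u + r v in lt_rho; have s0 : 0 < s by apply: addr_gt0.
have near x y a : 0 < a -> rho x y < s -> rho (x + (a / s) *: (y - x)) x < a :> R.
  move=> a0; rewrite /rho addrAC subrr add0r normrZ distrC gtr0_norm ?divr_gt0 // => h.
  by rewrite mulrAC ltr_pdivrMr // ltr_pM2l.
exists (p + (r u / s) *: (q - p)); split=> /=; first exact: near.
rewrite (_ : p + _ = q + (r v / s) *: (p - q)).
  by apply: near; rewrite // /rho distrC.
have -> : r v / s = 1 - r u / s by rewrite /s; field; rewrite gt_eqF.
by apply/rowP => i; rewrite !mxE; ring.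
Qed.

Lemma representation_realizable : (0 < #|G|)%N -> (0 < d)%N /\ realizable R d G.
Proof.
case/card_gt0P=> x _; have [y xy _] := representation_short rep x.
have yx : x != y by apply: contraTneq xy => ->; rewrite adj_irrefl.
split.
  by have [f] := representation_separates rep xy; rewrite /d; case: (fs).
have cardP : #|` P| = #|G| by rewrite card_imfset -?cardE //; exact: point_inj.
exists P; split.
  by rewrite cardP; apply/card_gt1P; exists x, y.
exists (fun v => [` pointP v]%fset : SIG_graph P).
  by apply: inj_card_bij; [move=> u v [/point_inj] | rewrite -cardfE cardP].
move=> u v; rewrite /= /SIG_adj /= -val_eqE /= (inj_eq point_inj).
have [->|uv] := eqVneq u v; first by rewrite adj_irrefl.
by rewrite adj_rho //=; apply/asboolP/idP => /(influence_meet uv).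
Qed.
End Realization.

Theorem theorem1p3 (R : realType) (G : sgraph) (n : nat)
    (hn : (1 <= n)%N) (hG : graph_order G = n)
    (hiso : forall v : G, ~~ isolated v) :
  ((SIG R G)%:Z <= Num.floor ((2 * n)%:R / 3 : R) + 2) /\
  (~~ (3 %| n)%N ->
   (SIG R G)%:Z <= Num.ceil ((2 * n)%:R / 3 : R) + 1).
Proof.
have nbr (v : G) : exists w, adj v w.
  by have := hiso v; rewrite /isolated /degree => /pred0Pn[w vw]; exists w.
have [r [fs [rep size_fs]]] := small_representation R (@adj_sym G) (@adj_irrefl G) nbr.
have n0 : (0 < #|G|)%N by move: hn; rewrite -hG.
have [d0 real] := representation_realizable rep n0.
have [_ _ /(_ _ d0 real) leSIG] := SIG_spec R n0 hiso.
have SIG_le : (3 * SIG R G <= 2 * n + 6)%N.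
  by apply: leq_trans (leq_trans size_fs _); rewrite ?leq_mul2l ?leSIG ?orbT // -hG.
set q := (2 * n)%:R / 3 : R; pose a := ((2 * n) %/ 3)%N.
have qE : q = a%:R + ((2 * n) %% 3)%N%:R / 3.
  by rewrite /q {1}(divn_eq (2 * n) 3) -/a natrD natrM mulrDl mulfK ?pnatr_eq0.
have mod_lt : ((2 * n) %% 3 < 3)%N by rewrite ltn_pmod.
have le_a : (SIG R G <= a + 2)%N by rewrite /a; lia.
have floor_q : Num.floor q = a%:Z.
  apply: floor_def; rewrite qE intrD -pmulrn.
  have : ((2 * n) %% 3)%N%:R < 3 :> R by rewrite ltr_nat.
  have : 0 <= ((2 * n) %% 3)%N%:R :> R by [].
  by move=> *; apply/andP; split; lra.
split; first by rewrite floor_q; lia.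
move=> n3; have : a%:Z < Num.ceil q; last by lia.
rewrite ceil_gt_int qE -pmulrn ltrDl divr_gt0 // ltr0n lt0n.
apply: contra n3 => /eqP mod0; lia.
Qed.
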